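(* Let $A:\mathbb{H}\rightrightarrows\mathbb{H}$ and $B:\mathbb{H}\rightrightarrows\mathbb{H}$ be respectively maximally $\alpha$- and $\beta$-monotone with $\alpha+\beta\ge0$. Suppose that $\gamma,\delta>0$ and $\lambda,\mu\ge1$ satisfy $$1+2\gamma\alpha>0,\qquad\mu\in[2-2\gamma\beta,\,2+2\gamma\alpha],\qquad(\lambda-1)(\mu-1)=1,\qquad\delta=(\lambda-1)\gamma,$$ that $\operatorname{zer}(A+B)\neq\emptyset$, and that $\inf_{t\in[t_0,+\infty)}\theta(t)>0$. Write $T:=R_{\delta B}^{\mu}R_{\gamma A}^{\lambda}$, and, for a given $\epsilon\in(0,1)$, $w_1:=\epsilon\mu(2+2\gamma\alpha-\mu)$ and $w_2:=\epsilon\mu(\mu-(2-2\gamma\beta))$. Let $u(t)$ be the trajectory (unique strong global solution) of $$\frac{du}{dt}+\theta(t)\,[u(t)-T(u(t))]=f(t),\qquad u(t_0)=u_0\in\mathbb{H}.$$ Then, for any $u^*\in\operatorname{Fix}(T)$: (i) $\int_{t_0}^{+\infty}\|Tu(s)-u(s)\|^2ds<+\infty$. (ii) $\lim_{t\to+\infty}\|Tu(t)-u(t)\|=0$. (iii) There exists $\hat u\in\operatorname{Fix}(T)$ such that $u(t)$ converges weakly to $\hat u$ as $t\to+\infty$. (iv) If $\alpha+\beta>0$, then $$\int_{t_0}^{+\infty}\|w_1(J_{\gamma A}u(s)-J_{\gamma A}u^* )+w_2(J_{\delta B}R_{\gamma A}^{\lambda}u(s)-J_{\delta B}R_{\gamma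 A}^{\lambda}u^* )\|^2ds<+\infty,$$ $$\lim_{t\to+\infty}\|w_1(J_{\gamma A}u(t)-J_{\gamma A}u^* )+w_2(J_{\delta B}R_{\gamma A}^{\lambda}u(t)-J_{\delta B}R_{\gamma A}^{\lambda}u^* )\|=0,$$ and $\lim_{t\to+\infty}J_{\gamma A}u(t)=J_{\gamma A}u^*=\lim_{t\to+\infty}J_{\delta B}R_{\gamma A}^{\lambda}u(t)=J_{\delta B}R_{\gamma A}^{\lambda}u^*$ (limits in norm), this common point being the unique element of $\operatorname{zer}(A+B)$.
   Context: $\mathbb{H}$ is a real Hilbert space, $I$ its identity operator, $t_0>0$, $\theta:[t_0,+\infty)\to[0,+\infty)$ is locally integrable, and $f:[t_0,+\infty)\to\mathbb{H}$ belongs to $L^1([t_0,+\infty))$. A set-valued operator $A:\mathbb{H}\rightrightarrows\mathbb{H}$ is $\alpha$-monotone ($\alpha\in\mathbb{R}$) if $\langle x-y,u-v\rangle\ge\alpha\|x-y\|^2$ whenever $u\in Ax$, $v\in Ay$; it is maximally $\alpha$-monotone if moreover no $\alpha$-monotone operator has a graph strictly containing that of $A$. $J_{\gamma A}=(I+\gamma A)^{-1}$, $R_{\gamma A}^{\lambda}=(1-\lambda)I+\lambda J_{\gamma A}$, $J_{\delta B}=(I+\delta B)^{-1}$, $R_{\delta B}^{\mu}=(1-\mu)I+\mu J_{\delta B}$; under the hypotheses of the claim these are single-valued with full domain (known). $\operatorname{zer}(A+B)=\{x:0\in Ax+Bx\}$; $\operatorname{Fix}(T)=\{x:Tx=x\}$.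 A strong global solution is a function $u:[t_0,+\infty)\to\mathbb{H}$ that is absolutely continuous on each interval $[t_0,b]$, $t_0<b<+\infty$, satisfies the differential equation for almost every $t\ge t_0$, and satisfies $u(t_0)=u_0$; it exists and is unique here. *)

(* Defs.v *)
From HB Require Import structures.
From mathcomp Require Import all_boot all_order all_algebra.
From mathcomp Require Import all_classical all_reals all_analysis.

Set Implicit Arguments.
Unset Strict Implicit.
Unset Printing Implicit Defensive.

Import Order.TTheory GRing.Theory Num.Theory.
Import numFieldNormedType.Exports.

Local Open Scope classical_set_scope.
Local Open Scope ring_scope.

(* A real Hilbert space is a complete normed module [H] with a symmetric
   positive definite bilinear form [ip] that induces its norm. *)
Definition hilbert_norm (R : realType) (H : completeNormedModType R)
    (ip : {dot H for idfun}) : Prop :=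
  forall x : H, `|x| ^+ 2 = ip x x.

Definition weak_cvg (R : realType) (H : completeNormedModType R)
    (ip : {dot H for idfun}) (u : R -> H) (l : H) : Prop :=
  forall v : H, ip (u t) v @[t --> +oo] --> ip l v.

Section Operators.
Context {R : realType} {H : completeNormedModType R}.
Implicit Types (A B : H -> set H) (T : H -> H).

Definition graph A : set (H * H) := [set z | A z.1 z.2].

Definition monotone_op (ip : {dot H for idfun}) (alpha : R) A : Prop :=
  forall x y u v : H, A x u -> A y v ->
    alpha * `|x - y| ^+ 2 <= ip (x - y) (u - v).

Definition maximally_monotone_op (ip : {dot H for idfun}) (alpha : R) A : Prop :=
  monotone_op ip alpha A /\
  forall A', monotone_op ip alpha A' -> ~ (graph A `<` graph A').

(* The set-valued operator (I + gamma A)^-1. *)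
Definition resolvent_set (gamma : R) A (x : H) : set H :=
  [set p | exists2 a, A p a & x = p + gamma *: a].

(* [get] picks the element of [resolvent_set gamma A x]; its value carries no
   meaning when that set is not a singleton. *)
Definition resolvent (gamma : R) A (x : H) : H := get (resolvent_set gamma A x).

Definition relaxed_resolvent (gamma lambda : R) A (x : H) : H :=
  (1 - lambda) *: x + lambda *: resolvent gamma A x.

Definition zer_sum A B : set H :=
  [set x | exists a b, [/\ A x a, B x b & a + b = 0]].

Definition Fix T : set H := [set x | T x = x].

End Operators.

Section Functions.
Context {R : realType} {V : normedModType R}.
Implicit Types (g u : R -> V) (D : set R).

(* Bochner measurability: a.e. limit of simple functions. For [V := R^o] this is
   Lebesgue measurability, whereas [measurable_fun] would be Borel. *)
Definition strongly_measurable D g : Prop :=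
  exists s : nat -> R -> V,
    (forall n, finite_set (range (s n)) /\
               forall v : V, measurable (s n @^-1` [set v])) /\
    {ae (@lebesgue_measure R), forall t, D t -> s n t @[n --> \oo] --> g t}.

Definition bochner_integrable D g : Prop :=
  strongly_measurable D g /\
  (\int[@lebesgue_measure R]_(t in D) (`|g t|)%:E < +oo)%E.

Definition abs_continuous (a b : R) u : Prop :=
  forall e : R, 0 < e -> exists2 d : R, 0 < d &
    forall (n : nat) (x y : 'I_n -> R),
      (forall i, [/\ a <= x i, x i <= y i & y i <= b]) ->
      trivIset setT (fun i => `]x i, y i[%classic) ->
      \sum_i (y i - x i) < d ->
      \sum_i `|u (y i) - u (x i)| < e.

End Functions.

Definition locally_integrable_from (R : realType) (t0 : R) (theta : R -> R) : Prop :=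
  forall b : R, t0 < b -> bochner_integrable `[t0, b] (theta : R -> R^o).

Definition strong_global_solution (R : realType) (H : completeNormedModType R)
    (t0 : R) (theta : R -> R) (T : H -> H) (f : R -> H) (u0 : H) (u : R -> H)
    : Prop :=
  [/\ forall b : R, t0 < b -> abs_continuous t0 b u,
      {ae (@lebesgue_measure R), forall t, t0 <= t ->
         derivable u t 1 /\ derive1 u t + theta t *: (u t - T (u t)) = f t}
    & u t0 = u0].

(* Main.v *)
(** The scheme satisfies x - Tx = mu (J_A x - J_B R_A x), so the monotonicity
    inequalities of the two resolvents give, with kappa1 = 2 + 2 gamma alpha - mu
    and kappa2 = mu - (2 - 2 gamma beta), both nonnegative,
      <x - y, (x - Tx) - (y - Ty)> >= 1/2 |(x - Tx) - (y - Ty)|^2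
        + mu/2 (kappa1 |J_A x - J_A y|^2 + kappa2 |J_B R_A x - J_B R_A y|^2).
    In particular T is nonexpansive.  Along the trajectory, for a fixed point p,
    one explicit Euler step shows that |u - p| and |u - Tu| have upper right Dini
    derivatives at most |f| and 2 |f| almost everywhere, and that the derivative
    of |u - p|^2 is at most 2 M |f| - 2 theta <u - p, u - Tu>.  An absolutely
    continuous function is controlled by such a bound, so <u - p, u - Tu> is
    integrable, |u - p| converges and |u - Tu| tends to 0.  Weak convergence
    follows without weak compactness: the asymptotic centre of u along any filter
    finer than +oo is a fixed point of T, and since |u - p| converges for every
    fixed point p, all these centres coincide.  That the resolvents are defined
    everywhere is Minty's theorem, obtained by minimizing the Fitzpatrick function
    plus half the squared norm. *)
Require Import Defs.
From HB Require Import structures.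
From mathcomp Require Import all_boot all_order all_algebra.
From mathcomp Require Import all_classical all_reals all_analysis.
From mathcomp Require Import measurable_realfun ring lra.
Import Order.TTheory GRing.Theory Num.Theory.
Import numFieldNormedType.Exports.
Local Open Scope classical_set_scope.
Local Open Scope ring_scope.

(** * Inner products and uniformly convex minimization *)

Section InnerProduct.
Context {R : realType} {H : completeNormedModType R} (ip : {dot H for idfun}).

Lemma ipC x y : ip x y = ip y x.
Proof. by rewrite hermC /= expr0 mul1r. Qed.

Lemma ipDl x y z : ip (x + y) z = ip x z + ip y z.
Proof. exact: linearDl. Qed.

Lemma ipNl x z : ip (- x) z = - ip x z.
Proof. exact: linearNl. Qed.

Lemma ipZl a x z : ip (a *: x) z = a * ip x z.
Proof. exact: linearZl_LR. Qed.

Lemma ipDr x y z : ip z (x + y) = ip z x + ip z y.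
Proof. by rewrite ipC ipDl !(ipC z). Qed.

Lemma ipNr x z : ip z (- x) = - ip z x.
Proof. by rewrite ipC ipNl (ipC z). Qed.

Lemma ipZr a x z : ip z (a *: x) = a * ip z x.
Proof. by rewrite ipC ipZl (ipC z). Qed.

Lemma ip0l x : ip 0 x = 0.
Proof. exact: linear0l. Qed.

Lemma ip0r x : ip x 0 = 0.
Proof. by rewrite ipC ip0l. Qed.

Definition ipE := (ipDl, ipDr, ipNl, ipNr, ipZl, ipZr).

Context (ip_norm : hilbert_norm ip).

Lemma normrD_sqr x y : `|x + y| ^+ 2 = `|x| ^+ 2 + 2 * ip x y + `|y| ^+ 2.
Proof. by rewrite !ip_norm !ipE (ipC y x); ring. Qed.

Lemma normrB_sqr x y : `|x - y| ^+ 2 = `|x| ^+ 2 - 2 * ip x y + `|y| ^+ 2.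
Proof. by rewrite normrD_sqr ipNr normrN; ring. Qed.

Lemma CauchySchwarz_ip x y : `|ip x y| <= `|x| * `|y|.
Proof.
have [->|y0] := eqVneq y 0.
  by rewrite ip0r !normr0 mulr0.
have ny : 0 < `|y| ^+ 2 by rewrite exprn_gt0 // normr_gt0.
rewrite -(@ler_pXn2r _ 2) ?nnegrE ?mulr_ge0 // exprMn real_normK ?num_real //.
have : 0 <= `|(`|y| ^+ 2) *: x - ip x y *: y| ^+ 2 by rewrite exprn_ge0.
rewrite normrB_sqr !normrZ !exprMn !real_normK ?num_real // ipZl ipZr.
set a := `|x| ^+ 2; set b := `|y| ^+ 2 in ny *; set c := ip x y => h.
by rewrite -(ler_pM2l ny); nra.
Qed.

Lemma ip_cvg {T} {F : set_system T} {FF : Filter F} (u : T -> H) l v :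
  u t @[t --> F] --> l -> ip (u t) v @[t --> F] --> ip l v.
Proof.
move=> ul; apply/cvgrPdist_le => e e0.
have c0 : 0 < e / (`|v| + 1) by rewrite divr_gt0 // ltr_wpDl.
move/cvgrPdist_le : ul => /(_ _ c0).
apply: filterS => t; rewrite ler_pdivlMr ?ltr_wpDl // => h.
rewrite -ipNl -ipDl (le_trans (CauchySchwarz_ip _ _)) // (le_trans _ h) //.
by rewrite ler_wpM2l // lerDl.
Qed.

Lemma ip_cvg2 {T} {F : set_system T} {FF : Filter F} (u w : T -> H) l m :
  u t @[t --> F] --> l -> w t @[t --> F] --> m ->
  ip (u t) (w t) @[t --> F] --> ip l m.
Proof.
move=> ul wm.
have E x y : ip x y = 2^-1 * (`|x + y| * `|x + y| - `|x| * `|x| - `|y| * `|y|).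
  by rewrite -!expr2 normrD_sqr; field.
rewrite E; under eq_fun do rewrite E.
by apply: cvgMr; apply: cvgB; [apply: cvgB|]; apply: cvgM; apply: cvg_norm => //; apply: cvgD.
Qed.

End InnerProduct.

Section ProductComplete.
Context {U V : completeType}.

(** Supplies the completeness required to minimize over [H * H]: both projections of a Cauchy filter
    are Cauchy, and their limits form its limit. *)
Lemma prod_complete (F : set_system (U * V)%type) :
  ProperFilter F -> cauchy F -> exists l : U * V, F --> l.
Proof.
move=> FF Fc.
have c1 : cauchy (fst @ F).
  move=> A entA; rewrite near_simpl -near2E near_map2.
  by apply: Fc; apply: filterS (prod_entP entA (@entourageT V)) => ? [].
have c2 : cauchy (snd @ F).
  move=> A entA; rewrite near_simpl -near2E near_map2.
  by apply: Fc; apply: filterS (prod_entP (@entourageT U) entA) => ? [].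
exists (lim (fst @ F), lim (snd @ F)).
move=> A /(cvg_pair (cauchy_cvg _ c1) (cauchy_cvg _ c2)) h.
by apply: (@filterS _ F _ _ _ _ h) => -[].
Qed.

End ProductComplete.

Section Minimum.
Context {R : realType} {V : normedModType R}.

(* [K c] stands for the sublevel set [phi <= c] of a function [phi] that may take
   the value [+oo]. *)
Lemma uniformly_convex_min (K : R -> set V) (k b : R) : 0 < k ->
  (forall F : set_system V, ProperFilter F -> cauchy F -> exists l : V, F --> l) ->
  (forall c, closed (K c)) ->
  (forall c x, (forall e, 0 < e -> K (c + e) x) -> K c x) ->
  (forall c d, c <= d -> K c `<=` K d) ->
  (forall c x y, K c x -> K c y -> K (c - k * `|x - y| ^+ 2) (2^-1 *: (x + y))) ->
  (forall c x, K c x -> b <= c) ->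
  (exists c x, K c x) ->
  exists m x, K m x /\ forall c y, K c y -> m <= c.
Proof.
move=> k0 Vc Kcl Klim Kmono Kconv Kb Kne.
pose C := [set c | exists x, K c x].
have C0 : C !=set0 by case: Kne => c [x]; exists c, x.
have Clb : has_lbound C by exists b => c [x /Kb].
pose m := inf C.
have mC c x : K c x -> m <= c by move=> ?; apply: ge_inf => //; exists x.
have Kme e : 0 < e -> exists x, K (m + e) x.
  move=> e0; have [c [x Kx] ce] := inf_adherent e0 (conj C0 Clb).
  by exists x; apply: Kmono Kx; exact/ltW.
(* The sublevel sets just above the infimum form a Cauchy filter, whose limit is the minimizer. *)
pose F : set_system V := [set A | exists2 e, 0 < e & K (m + e) `<=` A].
have FF : ProperFilter F.
  apply: Build_ProperFilter_ex.
    by move=> A [e e0 eA]; have [x /eA] := Kme _ e0; exists x.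
  split.
  - by exists 1.
  - move=> P Q [e e0 eP] [d d0 dQ]; exists (Num.min e d).
      by rewrite lt_min e0.
    by move=> x Kx; split; [apply: eP|apply: dQ]; apply: Kmono Kx;
      rewrite lerD2l ge_min lexx ?orbT.
  - by move=> P Q PQ [e e0 eP]; exists e => // x /eP /PQ.
have Fc : cauchy F.
  apply: cauchy_exP => e e0.
  (* Two points at level [m + d] have a midpoint at level [m + d - k * |x - y|^2], which cannot lie
     below [m]; hence [|x - y|^2 <= e^2 / 2]. *)
  pose d := k * (e ^+ 2 / 2).
  have d0 : 0 < d by rewrite mulr_gt0 // divr_gt0 // exprn_gt0.
  have [x Kx] := Kme _ d0.
  exists x, d => // y Ky; rewrite -ball_normE /=.
  have /mC := Kconv _ _ _ Kx Ky.
  rewrite -addrA lerDl subr_ge0 /d ler_pM2l // => h.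
  rewrite -(@ltr_pXn2r _ 2) ?nnegrE ?(ltW e0) //.
  by apply: le_lt_trans h _; rewrite ltr_pdivrMr // ltr_pMr ?exprn_gt0 // ltr1n.
have [l Fl] := Vc F FF Fc.
exists m, l; split=> //.
apply: Klim => e e0; apply: (@closed_cvg _ _ F FF id _ (Kcl (m + e)) _ l Fl).
by exists e.
Qed.

End Minimum.

(** * Minty's theorem and resolvents *)

Section Minty.
Context {R : realType} {H : completeNormedModType R} (ip : {dot H for idfun}).
Context (ip_norm : hilbert_norm ip).

(** In place of dividing by [s] and letting it tend to 0: for negative [a], the value
    [s = - a / (|d| - a)] already makes [a + s * d] negative. *)
Lemma ge0_first_order (a d : R) :
  (forall s, 0 < s <= 1 -> 0 <= s * a + s ^+ 2 * d) -> 0 <= a.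
Proof.
move=> h; rewrite leNgt; apply/negP => a0.
have d0 : 0 < `|d| - a by rewrite subr_gt0 (lt_le_trans a0).
have d1 : `|d| / (`|d| - a) < 1 by rewrite ltr_pdivrMr // mul1r ltrDl oppr_gt0.
pose s := - a / (`|d| - a).
have s0 : 0 < s by rewrite divr_gt0 // oppr_gt0.
have s1 : s <= 1 by rewrite ler_pdivrMr // mul1r lerDr.
have := h s; rewrite s0 s1 => /(_ isT).
rewrite expr2 -mulrA -mulrDr pmulr_rge0 // leNgt => /negP; apply.
have : s * d <= - a * (`|d| / (`|d| - a)).
  by rewrite [leRHS]mulrA [leRHS]mulrAC ler_wpM2l ?(ltW s0) // ler_norm.
move/(lerD (lexx a))/le_lt_trans; apply.
by move: d1; set t := _ / _ => d1; nra.
Qed.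

Section Graph.
Context (G : set (H * H)).
Context (G_mono : forall z w, G z -> G w -> 0 <= ip (z.1 - w.1) (z.2 - w.2)).
Context (G_max : forall z, (forall w, G w -> 0 <= ip (z.1 - w.1) (z.2 - w.2)) -> G z).

(* Sublevel set of the Fitzpatrick function of [G] plus half the squared norm. *)
Let K (c : R) : set (H * H) := [set p | forall w, G w ->
  ip p.1 w.2 + ip w.1 p.2 - ip w.1 w.2 + (`|p.1| ^+ 2 + `|p.2| ^+ 2) / 2 <= c].

Let K_closed c : closed (K c).
Proof.
have -> : K c = \bigcap_(w in G) [set p : H * H |
  ip p.1 w.2 + ip w.1 p.2 - ip w.1 w.2 + (`|p.1| ^+ 2 + `|p.2| ^+ 2) / 2 <= c].
  by [].
apply: closed_bigI => w _.
apply: (preimage_closed _ (@closed_le _ c)) => p _.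
have c1 : x.1 @[x --> p] --> p.1 by exact: cvg_fst.
have c2 : x.2 @[x --> p] --> p.2 by exact: cvg_snd.
apply: cvgD.
  apply: cvgD; last exact: cvg_cst.
  apply: cvgD; first exact: ip_cvg.
  rewrite (ipC _ w.1); under eq_fun do rewrite (ipC _ w.1).
  exact: ip_cvg.
apply: cvgMl; apply: cvgD.
  exact: (cvgM (cvg_norm c1) (cvg_norm c1)).
exact: (cvgM (cvg_norm c2) (cvg_norm c2)).
Qed.

(** The Fitzpatrick function dominates the pairing [ip p.1 p.2]: some [w] in [G] has
    [ip (p.1 - w.1) (p.2 - w.2) <= 0], namely [p] itself if it lies in [G], and one given by
    maximality otherwise. *)
Let fitzpatrick_ge c p : K c p -> ip p.1 p.2 + (`|p.1| ^+ 2 + `|p.2| ^+ 2) / 2 <= c.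
Proof.
move=> Kp; have [w Gw h] : exists2 w, G w & ip (p.1 - w.1) (p.2 - w.2) <= 0.
  have [Gp|nGp] := pselect (G p).
    by exists p => //; rewrite subrr ip0l.
  apply: contra_notP nGp => nex; apply: G_max => w Gw.
  by rewrite leNgt; apply/negP => /ltW ?; apply: nex; exists w.
apply: le_trans (Kp _ Gw); rewrite lerD2r.
by move: h; rewrite !ipE; lra.
Qed.

(** The first-order condition at a minimizer [p] of the Fitzpatrick function plus half the squared
    norm places [(- p.2, - p.1)] in [G] and then forces [p.1 + p.2 = 0]. *)
Lemma minty_zero : exists2 z, G z & z.1 + z.2 = 0.
Proof.
have G0 : exists w, G w.
  have [//|nG] := pselect (exists w, G w).
  by exists (0, 0); apply: G_max => w Gw; case: nG; exists w.
(* The modulus [8^-1] comes from the half squared norm, the Fitzpatrick part being convex; the norm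
   of [H * H] is a maximum, so its square is at most the sum of the two squares. The lower bound 0
   is that of [|x.1 + x.2|^2 / 2]. *)
have [||||||||m [p [Kp mP]]] := @uniformly_convex_min R (H * H)%type K (8^-1) 0.
- by rewrite invr_gt0.
- exact: prod_complete.
- exact: K_closed.
- by move=> c x h w Gw; apply/ler_addgt0Pr => e e0; apply: h.
- by move=> c d cd x Kx w Gw; apply: le_trans cd; exact: Kx.
- move=> c x y Kx Ky w Gw /=; have := Kx w Gw; have := Ky w Gw.
  have : `|x - y| ^+ 2 <= `|x.1 - y.1| ^+ 2 + `|x.2 - y.2| ^+ 2.
    have := exprn_ge0 2 (normr_ge0 (x.1 - y.1)).
    have := exprn_ge0 2 (normr_ge0 (x.2 - y.2)).
    rewrite {3}/Num.norm /= /ProdNormedZmodule.norm.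
    case: (leP `|x.1 - y.1| `|x.2 - y.2|) => _; lra.
  rewrite !normrZ !exprMn (ger0_norm (_ : 0 <= 2^-1)) ?invr_ge0 //.
  rewrite !(normrB_sqr ip ip_norm) !(normrD_sqr ip ip_norm) !ipE; lra.
- move=> c x /fitzpatrick_ge; apply: le_trans.
  have : 0 <= `|x.1 + x.2| ^+ 2 by rewrite exprn_ge0.
  by rewrite (normrD_sqr ip ip_norm); lra.
- have [[y v] Gw] := G0; exists (ip y v + (`|y| ^+ 2 + `|v| ^+ 2) / 2), (y, v) => w Gw'.
  rewrite /= lerD2r; have := G_mono _ _ Gw Gw'; rewrite /= !ipE; lra.
(* first-order optimality of [p] in the direction [w - p] *)
have key w : G w -> `|p.1 + p.2| ^+ 2 <= ip (w.1 + p.2) (w.2 + p.1).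
  move=> Gw; rewrite -subr_ge0.
  pose D1 := `|w.1 - p.1| ^+ 2; pose D2 := `|w.2 - p.2| ^+ 2.
  apply: (@ge0_first_order _ ((D1 + D2) / 2)) => s /andP[s0 s1].
  pose N := (`|p.1| ^+ 2 + `|p.2| ^+ 2) / 2.
  have pm : ip p.1 p.2 + N <= m := fitzpatrick_ge _ _ Kp.
  (* The Fitzpatrick part is bounded along the segment by convexity: it is at most [m - N] at [p]
     and, by monotonicity, at most [ip w.1 w.2] at [w]. The squared norms are expanded exactly. *)
  have /mP : K ((1 - s) * (m - N) + s * ip w.1 w.2 + N
    + s * (ip p.1 (w.1 - p.1) + ip p.2 (w.2 - p.2))
    + s ^+ 2 * ((D1 + D2) / 2)) (p + s *: (w - p)).
    move=> w' Gw' /=; have h1 := Kp w' Gw'; have h2 := G_mono _ _ Gw Gw'.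
    have {}h1 : (1 - s) * (ip p.1 w'.2 + ip w'.1 p.2 - ip w'.1 w'.2) <= (1 - s) * (m - N).
      by rewrite ler_wpM2l ?subr_ge0 // lerBrDr.
    have {}h2 : s * (ip w.1 w'.2 + ip w'.1 w.2 - ip w'.1 w'.2) <= s * ip w.1 w.2.
      by rewrite ler_pM2l //; move: h2; rewrite !ipE; lra.
    rewrite !(normrD_sqr ip ip_norm) !normrZ !exprMn (gtr0_norm s0) -/D1 -/D2.
    by move: h1 h2; rewrite /N !ipE; lra.
  move: pm; rewrite (normrD_sqr ip ip_norm) !ipE -!ip_norm => pm h.
  have {}pm : s * (ip p.1 p.2 + N) <= s * m by rewrite ler_pM2l.
  move: pm h; rewrite /N (ipC _ p.2 w.2) (ipC _ p.2 p.1) (ipC _ w.1 p.1); lra.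
have Gq : G (- p.2, - p.1).
  apply: G_max => w Gw /=; apply: le_trans (exprn_ge0 2 (normr_ge0 (p.1 + p.2))) _.
  apply: le_trans (key _ Gw) _; rewrite -!opprD ipNl ipNr opprK.
  by rewrite (addrC p.2) (addrC p.1).
exists (- p.2, - p.1) => //=.
(* At [w = (- p.2, - p.1)] the right-hand side of [key] vanishes. *)
have := key _ Gq; rewrite /= !addNr ip0l => h.
have /eqP : `|p.1 + p.2| ^+ 2 = 0 by apply/eqP; rewrite eq_le h exprn_ge0.
by rewrite sqrf_eq0 normr_eq0 -opprD addrC => /eqP ->; rewrite oppr0.
Qed.

End Graph.

(** Translating the second coordinates by [x] reduces this to [minty_zero]. *)
Lemma minty (G : set (H * H)) (x : H) :
  (forall z w, G z -> G w -> 0 <= ip (z.1 - w.1) (z.2 - w.2)) ->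
  (forall z, (forall w, G w -> 0 <= ip (z.1 - w.1) (z.2 - w.2)) -> G z) ->
  exists2 z, G z & z.1 + z.2 = x.
Proof.
move=> mG MG; have [||z Gz z0] := @minty_zero [set z | G (z.1, z.2 + x)].
- by move=> z w /= Gz Gw; have := mG _ _ Gz Gw; rewrite /= opprD addrACA subrr addr0.
- move=> z h; apply: MG => w Gw /=.
  have /= := h (w.1, w.2 - x); rewrite subrK -surjective_pairing => /(_ Gw).
  by rewrite opprB addrA.
exists (z.1, z.2 + x) => //=; by rewrite addrA z0 add0r.
Qed.

(** Otherwise adjoining [(x, u)] to the graph would give a strictly larger [alpha]-monotone
    operator. *)
Lemma maximally_monotone_graph alpha (A : H -> set H) :
  maximally_monotone_op ip alpha A -> forall x u,
  (forall y v, A y v -> alpha * `|x - y| ^+ 2 <= ip (x - y) (u - v)) -> A x u.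
Proof.
move=> [mA maxA] x u h; apply: contrapT => nA.
apply: (maxA (fun y => A y `|` [set v | y = x /\ v = u])).
  move=> y z v w [Ayv|[-> ->]] [Azw|[-> ->]]; [exact: mA| |exact: h|].
    by rewrite distrC -[y - x]opprB -[v - u]opprB ipNl ipNr opprK; exact: h.
  by rewrite !subrr normr0 expr0n mulr0 ip0l.
split; first by move=> z /= Az; left.
by move=> /(_ (x, u)) /= /(_ (or_intror (conj erefl erefl))).
Qed.

(** Minty's theorem applies to a multiple of [A - alpha I], which inherits maximality from [A];
    [0 < 1 + gamma * alpha] makes that multiple positive. *)
Lemma resolvent_nonempty alpha gamma (A : H -> set H) :
  maximally_monotone_op ip alpha A -> 0 < gamma -> 0 < 1 + gamma * alpha ->
  forall x, resolvent_set gamma A x !=set0.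
Proof.
move=> maxA g0 ga0 x; have mA := maxA.1.
have AP := @maximally_monotone_graph _ _ maxA.
pose c := (1 + gamma * alpha)^-1.
have c0 : 0 < c by rewrite invr_gt0.
have cg0 : 0 < c * gamma by rewrite mulr_gt0.
have cE : c + c * gamma * alpha = 1.
  by rewrite -mulrA -[X in X + _]mulr1 -mulrDr mulVf // gt_eqF.
(* [I + gamma A = c^-1 (I + c gamma (A - alpha I))] *)
pose G := [set z : H * H | exists2 a, A z.1 a & z.2 = (c * gamma) *: (a - alpha *: z.1)].
have [||z [a Aa z2] zE] := @minty G (c *: x).
- move=> [y _] [y' _] [v /= Av ->] [v' /= Av' ->] /=.
  rewrite -scalerBr ipZr pmulr_rge0 // opprB addrACA.
  have := mA _ _ _ _ Av Av'; rewrite ip_norm !ipE; lra.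
- move=> [y q] h /=; exists ((c * gamma)^-1 *: q + alpha *: y); last first.
    by rewrite addrK scalerA mulfV ?scale1r // gt_eqF.
  apply: AP => y' v Av; have /= := h (y', (c * gamma) *: (v - alpha *: y')).
  move=> /(_ (ex_intro2 _ _ _ Av erefl)).
  rewrite -(@pmulr_rge0 _ (c * gamma)^-1) ?invr_gt0 // -ipZr scalerBr scalerA.
  rewrite mulVf ?gt_eqF // scale1r ip_norm !ipE; lra.
exists z.1, a => //; apply: (@scalerI _ _ c); first by rewrite gt_eqF.
rewrite -zE z2 -{1}[z.1]scale1r -cE scalerDl scalerBr scalerDr !scalerA.
by rewrite addrACA subrr addr0.
Qed.

End Minty.

(** * The adaptive Douglas-Rachford operator *)

Section AdaptiveDouglasRachford.
Context {R : realType} {H : completeNormedModType R} (ip : {dot H for idfun}).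
Context (ip_norm : hilbert_norm ip).

Lemma resolventP alpha gamma (A : H -> set H) :
  maximally_monotone_op ip alpha A -> 0 < gamma -> 0 < 1 + gamma * alpha ->
  forall x, resolvent_set gamma A x (resolvent gamma A x).
Proof.
move=> maxA g0 ga0 x.
have [p Ap] := resolvent_nonempty ip ip_norm _ _ _ maxA g0 ga0 x.
exact: (getPex (ex_intro _ p Ap)).
Qed.

Lemma resolvent_strongly_firm alpha gamma (A : H -> set H) :
  maximally_monotone_op ip alpha A -> 0 < gamma -> 0 < 1 + gamma * alpha ->
  forall x y, (1 + gamma * alpha) * `|resolvent gamma A x - resolvent gamma A y| ^+ 2
    <= ip (resolvent gamma A x - resolvent gamma A y) (x - y).
Proof.
move=> maxA g0 ga0 x y.
have [a Aa xE] := resolventP _ _ _ maxA g0 ga0 x.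
have [b Ab yE] := resolventP _ _ _ maxA g0 ga0 y.
set p := resolvent gamma A x in Aa xE *; set q := resolvent gamma A y in Ab yE *.
rewrite {1}xE {1}yE mulrDl mul1r opprD addrACA -scalerBr ipDr -ip_norm lerD2l ipZr.
by rewrite -mulrA ler_pM2l //; exact: maxA.1.
Qed.

Context (A B : H -> set H) (alpha beta gamma delta lambda mu : R).
Context (A_max : maximally_monotone_op ip alpha A).
Context (B_max : maximally_monotone_op ip beta B).
Context (gamma_gt0 : 0 < gamma) (delta_gt0 : 0 < delta).
Context (mu_ge1 : 1 <= mu).
Context (gamma_alpha : 0 < 1 + 2 * gamma * alpha).
Context (mu_itv : 2 - 2 * gamma * beta <= mu <= 2 + 2 * gamma * alpha).
Context (lambda_mu : (lambda - 1) * (mu - 1) = 1).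
Context (delta_def : delta = (lambda - 1) * gamma).

Let JA := resolvent gamma A.
Let RA := relaxed_resolvent gamma lambda A.
Let JB := resolvent delta B.
Let T := relaxed_resolvent delta mu B \o RA.
Let kappa1 := 2 + 2 * gamma * alpha - mu.
Let kappa2 := mu - (2 - 2 * gamma * beta).

Let mu_gt1 : 0 < mu - 1.
Proof.
rewrite lt0r subr_ge0 mu_ge1 andbT; apply/eqP => m0.
by move/eqP: lambda_mu; rewrite m0 mulr0 eq_sym oner_eq0.
Qed.

Let alpha_gt0 : 0 < 1 + gamma * alpha.
Proof. by move: gamma_alpha; lra. Qed.

Let mu_beta : (mu - 1) * (1 + delta * beta) = mu - 1 + gamma * beta.
Proof.
rewrite delta_def mulrDr mulr1; congr (_ + _).
have -> : (mu - 1) * ((lambda - 1) * gamma * beta) =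
  (lambda - 1) * (mu - 1) * (gamma * beta) by ring.
by rewrite lambda_mu mul1r.
Qed.

(** The lower end of the range of [mu] gives [gamma * beta >= 1 - mu / 2], so
    [mu - 1 + gamma * beta] is at least [mu / 2]. *)
Let beta_gt0 : 0 < 1 + delta * beta.
Proof.
by rewrite -(@pmulr_rgt0 _ (mu - 1)) // mu_beta; case/andP: mu_itv; move: mu_gt1; lra.
Qed.

(** Since [(1 - mu) * (1 - lambda) = 1], the term of [T x] in [x] has coefficient 1 and cancels. *)
Lemma sub_DouglasRachford x : x - T x = mu *: (JA x - JB (RA x)).
Proof.
rewrite /T /= /relaxed_resolvent -/JB -/JA -/RA -/(relaxed_resolvent _ _ _) -/RA.
rewrite opprD addrA scalerBr; congr (_ - _).
rewrite scalerDr !scalerA.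
have -> : (1 - mu) * (1 - lambda) = (lambda - 1) * (mu - 1) by ring.
have -> : (1 - mu) * lambda = - mu.
  have -> : (1 - mu) * lambda = - ((lambda - 1) * (mu - 1)) + (1 - mu) by ring.
  by rewrite lambda_mu; ring.
by rewrite lambda_mu scale1r opprD addNKr scaleNr opprK.
Qed.

Lemma DouglasRachford_monotone x y :
  `|(x - T x) - (y - T y)| ^+ 2 / 2 + mu / 2 * (kappa1 * `|JA x - JA y| ^+ 2
    + kappa2 * `|JB (RA x) - JB (RA y)| ^+ 2)
  <= ip (x - y) ((x - T x) - (y - T y)).
Proof.
have hA := resolvent_strongly_firm _ _ _ A_max gamma_gt0 alpha_gt0 x y.
have hB := resolvent_strongly_firm _ _ _ B_max delta_gt0 beta_gt0 (RA x) (RA y).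
rewrite !sub_DouglasRachford -scalerBr.
rewrite -/JA -/JB in hA hB *.
have RE : RA x - RA y = (1 - lambda) *: (x - y) + lambda *: (JA x - JA y).
  by rewrite /RA /relaxed_resolvent opprD addrACA -!scalerBr.
have -> : (JA x - JB (RA x)) - (JA y - JB (RA y)) = (JA x - JA y) - (JB (RA x) - JB (RA y)).
  by rewrite !opprD addrACA.
move: hA hB; rewrite RE.
move: (JA x - JA y) (JB (RA x) - JB (RA y)) (x - y) => a b X hA hB.
have mu0 : 0 < mu by apply: lt_le_trans mu_ge1.
rewrite normrZ exprMn (gtr0_norm mu0) (normrB_sqr ip ip_norm) ipZr.
(* The inequality is multiplied by [mu - 1], because [mu - 1] times the difference of the [RA]
   values is [- X + mu *: a]. *)
have {}hB : (mu - 1 + gamma * beta) * `|b| ^+ 2 <= - ip b X + mu * ip b a.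
  rewrite -mu_beta -mulrA -[_ + mu * _](_ : (mu - 1) * ip b ((1 - lambda) *: X + lambda *: a) = _).
    by rewrite ler_pM2l.
  have e1 : (mu - 1) * (1 - lambda) = -1.
    have -> : (mu - 1) * (1 - lambda) = - ((lambda - 1) * (mu - 1)) by ring.
    by rewrite lambda_mu.
  have e2 : (mu - 1) * lambda = mu.
    have -> : (mu - 1) * lambda = (lambda - 1) * (mu - 1) + (mu - 1) by ring.
    by rewrite lambda_mu; ring.
  by rewrite ipDr !ipZr mulrDr !mulrA e1 e2 mulN1r.
(* Once the common factor [mu] is removed, the claim is the sum of [hA] and [hB]. *)
rewrite -[X in X <= _](_ : mu * (mu / 2 * (`|a| ^+ 2 - 2 * ip a b + `|b| ^+ 2)
  + (kappa1 / 2 * `|a| ^+ 2 + kappa2 / 2 * `|b| ^+ 2)) = _); last by field.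
rewrite ler_pM2l // ipDr ipNr (ipC _ X a) (ipC _ X b).
by move: hA hB; rewrite /kappa1 /kappa2 (ipC _ b a); lra.
Qed.

Let kappa_ge0 : 0 <= kappa1 /\ 0 <= kappa2.
Proof. by case/andP: mu_itv => ? ?; split; rewrite /kappa1 /kappa2; lra. Qed.

Lemma DouglasRachford_cocoercive x y :
  `|(x - T x) - (y - T y)| ^+ 2 / 2 <= ip (x - y) ((x - T x) - (y - T y)).
Proof.
apply: le_trans (DouglasRachford_monotone x y); rewrite lerDl.
have [k1 k2] := kappa_ge0; have mu0 : 0 <= mu / 2.
  by rewrite divr_ge0 //; apply: le_trans mu_ge1.
by rewrite mulr_ge0 // addr_ge0 // mulr_ge0 // exprn_ge0.
Qed.

(** With [d] the difference of the residuals, [|T x - T y|^2 = |x - y|^2 - 2 <x - y, d> + |d|^2],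
    and cocoercivity makes the last two terms at most 0 together. *)
Lemma DouglasRachford_nonexpansive x y : `|T x - T y| <= `|x - y|.
Proof.
rewrite -(@ler_pXn2r _ 2) ?nnegrE //.
have -> : T x - T y = (x - y) - ((x - T x) - (y - T y)).
  have -> : (x - T x) - (y - T y) = (x - y) - (T x - T y) by rewrite !opprD addrACA.
  by rewrite subKr.
have := DouglasRachford_cocoercive x y; rewrite (normrB_sqr ip ip_norm (x - y)); lra.
Qed.

Lemma Fix_DouglasRachford x : Fix T x -> JA x = JB (RA x).
Proof.
move=> Tx; have := sub_DouglasRachford x; rewrite (Tx : T x = x) subrr => /esym/eqP.
by rewrite scaler_eq0 subr_eq0 gt_eqF ?(lt_le_trans _ mu_ge1) //= => /eqP.
Qed.

(** At a fixed point the two resolvent equations give opposite values of [A] and [B] at [JA x].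
    Adding the two monotonicity inequalities excludes any other zero, as [alpha + beta] is
    positive. *)
Lemma zer_sum_DouglasRachford x : 0 < alpha + beta -> Fix T x ->
  zer_sum A B = [set JA x].
Proof.
move=> ab0 Tx; have JE := Fix_DouglasRachford _ Tx.
have [a Aa xE] := resolventP _ _ _ A_max gamma_gt0 alpha_gt0 x.
have [b Bb RE] := resolventP _ _ _ B_max delta_gt0 beta_gt0 (RA x).
rewrite -/JA in Aa xE; rewrite -/JB -JE in Bb RE.
(* [delta *: b = RA x - JA x = (1 - lambda) *: (x - JA x)], and [x - JA x = gamma *: a]. *)
have ba : b = - a.
  have l0 : lambda - 1 != 0.
    by apply/eqP => l0; move/eqP: lambda_mu; rewrite l0 mul0r eq_sym oner_eq0.
  apply: (@scalerI _ _ delta); first by rewrite gt_eqF.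
  have {}RE : delta *: b = RA x - JA x by rewrite RE addrAC subrr add0r.
  rewrite RE /RA /relaxed_resolvent -/JA {1}xE delta_def scalerN -scalerA -scaleNr opprB.
  by rewrite scalerDr [X in X - _]addrAC -scalerDl subrK scale1r addrAC subrr add0r.
apply/seteqP; split=> [z [a' [b' [Aa' Bb' ab]]]|_ ->] /=; last first.
  by exists a, b; split=> //; rewrite ba subrr.
have := A_max.1 _ _ _ _ Aa' Aa; have := B_max.1 _ _ _ _ Bb' Bb.
have -> : b' = - a' by apply/eqP; rewrite -addr_eq0 addrC ab.
rewrite ba !ipDr !ipNr => h1 h2.
have : (alpha + beta) * `|z - JA x| ^+ 2 <= 0 by rewrite mulrDl; lra.
rewrite pmulr_rle0 // => h; apply/eqP; rewrite -subr_eq0 -normr_eq0 -sqrf_eq0.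
by rewrite eq_le h exprn_ge0.
Qed.

End AdaptiveDouglasRachford.

(** * Absolutely continuous functions and Dini derivatives *)

Section AbsoluteContinuity.
Context {R : realType}.
Notation mu := (@lebesgue_measure R).

Lemma abs_continuous_uniform {V : normedModType R} (a b : R) (u : R -> V) :
  abs_continuous a b u -> forall e, 0 < e -> exists2 d, 0 < d &
  forall x y, a <= x -> x <= y -> y <= b -> y - x < d -> `|u y - u x| < e.
Proof.
move=> uac e /uac [d d0 h]; exists d => // x y ax xy yb yxd.
have := h 1%N (fun=> x) (fun=> y); rewrite !big_ord1; apply=> //.
by move=> i j _ _ _; rewrite (ord1 i) (ord1 j).
Qed.

Lemma abs_continuous_comp {V W : normedModType R} (a b c : R) (u : R -> V) (v : R -> W) :
  (forall x y, a <= x <= b -> a <= y <= b -> `|v y - v x| <= c * `|u y - u x|) ->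
  abs_continuous a b u -> abs_continuous a b v.
Proof.
move=> vu uac e e0.
have c0 : 0 < `|c| + 1 by rewrite ltr_wpDl.
have [|d d0 h] := uac (e / (`|c| + 1)); first by rewrite divr_gt0.
exists d => // n x y xy tr sd; have := h n x y xy tr sd.
rewrite ltr_pdivlMr // mulr_suml; apply: le_lt_trans; apply: ler_sum => i _.
have [ax xyi yb] := xy i.
apply: le_trans (vu _ _ _ _) _; rewrite ?ax ?yb ?andbT ?(le_trans xyi) ?(le_trans ax) //.
by rewrite mulrC ler_wpM2l // (le_trans (ler_norm _)) // lerDl.
Qed.

Lemma abs_continuousB {V : normedModType R} (a b : R) (u v : R -> V) :
  abs_continuous a b u -> abs_continuous a b v ->
  abs_continuous a b (fun t => u t - v t).
Proof.
move=> uac vac e e0; have e20 : 0 < e / 2 by rewrite divr_gt0.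
have [d d0 hu] := uac _ e20; have [d' d'0 hv] := vac _ e20.
exists (Num.min d d'); first by rewrite lt_min d0.
move=> n x y xy tr; rewrite lt_min => /andP[sd sd'].
have := hu n x y xy tr sd; have := hv n x y xy tr sd'.
rewrite [X in _ -> _ -> _ < X]splitr => h1 h2; apply: le_lt_trans (ltrD h2 h1).
rewrite -big_split /=; apply: ler_sum => i _.
have -> : u (y i) - v (y i) - (u (x i) - v (x i)) =
  (u (y i) - u (x i)) - (v (y i) - v (x i)) by rewrite !opprD addrACA.
exact: ler_normB.
Qed.

Section Creeping.
Context (a b : R) (psi : R -> R^o) (U : set R).

Let intervals n (x y : 'I_n -> R) (c : R) :=
  [/\ forall i, [/\ a <= x i, x i <= y i & y i <= c],
      trivIset setT (fun i => `]x i, y i[%classic) &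
      forall i, `]x i, y i[ `<=` U].

(** The supremum of this set is the variation of [psi] inside [U] up to [c]. *)
Let variations (c : R) : set R := [set s | exists n (x y : 'I_n -> R),
  intervals n x y c /\ s = \sum_i `|psi (y i) - psi (x i)|].

Let variations0 c : variations c 0.
Proof.
exists 0%N, (fun=> 0), (fun=> 0); rewrite big_ord0; split=> //.
by split=> [[]|[]|[]].
Qed.

Let variationsS c d s : c <= d -> variations c s -> variations d s.
Proof.
move=> cd [n [x [y [[xy tr xyU] ->]]]]; exists n, x, y; split=> //; split=> // i.
by have [? ? ?] := xy i; split=> //; apply: le_trans cd.
Qed.

(** The interval []c, d[] is appended at the last index; it is disjoint from the others because
    these end by [c]. *)
Let variationsD c d s : a <= c -> c <= d -> `]c, d[ `<=` U -> variations c s ->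
  variations d (s + `|psi d - psi c|).
Proof.
move=> ac cd cdU [n [x [y [[xy tr xyU] ->]]]].
pose ext (z : 'I_n -> R) w (i : 'I_n.+1) := if unlift ord_max i is Some j then z j else w.
have ext_max z w : ext z w ord_max = w by rewrite /ext unlift_none.
have ext_lift z w j : ext z w (lift ord_max j) = z j by rewrite /ext liftK.
exists n.+1, (ext x c), (ext y d); split; last first.
  rewrite big_ord_recr /= !ext_max; congr (_ + _).
  apply: eq_bigr => i _; have -> : widen_ord (leqnSn n) i = lift ord_max i.
    by apply: val_inj; rewrite /= /bump leqNgt ltn_ord.
  by rewrite !ext_lift.
split.
- move=> i; case: (unliftP ord_max i) => [j ->|->]; rewrite ?ext_lift ?ext_max //.
  by have [? ? ?] := xy j; split=> //; apply: le_trans cd.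
- move=> i j _ _.
  case: (unliftP ord_max i) => [i' ->|->]; case: (unliftP ord_max j) => [j' ->|->];
    rewrite ?ext_lift ?ext_max //.
  + by move=> /(tr i' j' I I) ->.
  + move=> [t [/=]]; rewrite !in_itv /= => /andP[_ tyi] /andP[ct _].
    by have [_ _ yc] := xy i'; move: (lt_trans ct (lt_le_trans tyi yc)); rewrite ltxx.
  + move=> [t [/=]]; rewrite !in_itv /= => /andP[ct _] /andP[_ tyi].
    by have [_ _ yc] := xy j'; move: (lt_trans ct (lt_le_trans tyi yc)); rewrite ltxx.
- by move=> i; case: (unliftP ord_max i) => [j ->|->]; rewrite ?ext_lift ?ext_max.
Qed.

(* A bad point of [U] is crossed at the price of the variation of [psi] inside
   [U]; everywhere else the slope is at most [e]. *)
Lemma creeping_le (e M : R) : a <= b -> 0 < e -> open U ->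
  (forall n (x y : 'I_n -> R),
    (forall i, [/\ a <= x i, x i <= y i & y i <= b]) ->
    trivIset setT (fun i => `]x i, y i[%classic) ->
    (forall i, `]x i, y i[ `<=` U) ->
    \sum_i `|psi (y i) - psi (x i)| <= M) ->
  (forall d, 0 < d -> exists2 r, 0 < r &
    forall x y, a <= x -> x <= y -> y <= b -> y - x < r -> `|psi y - psi x| < d) ->
  (forall t, a <= t < b -> ~ U t ->
    exists2 h, 0 < h & psi (t + h) - psi t <= e * h /\ t + h <= b) ->
  psi b - psi a <= e * (b - a) + M.
Proof.
move=> ab e0 Uo VM pc dini.
pose V c := sup (variations c).
have vub c : c <= b -> has_sup (variations c).
  move=> cb; split; first by exists 0.
  exists M => s /(variationsS _ _ _ cb) [n [x [y [[xy tr xyU] ->]]]].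
  exact: VM.
have Vmono c d : c <= d -> d <= b -> V c <= V d.
  move=> cd db; apply: ge_sup; first by exists 0.
  by move=> s /(variationsS _ _ _ cd) vs; apply: (sup_ubound (vub _ db).2).
have V0 c : c <= b -> 0 <= V c by move=> cb; apply: (sup_ubound (vub _ cb).2).
have Vstep c d : a <= c -> c <= d -> d <= b -> `]c, d[ `<=` U ->
    V c + `|psi d - psi c| <= V d.
  move=> ac cd db cdU; rewrite -lerBrDr; apply: ge_sup; first by exists 0.
  move=> s vs; rewrite lerBrDr; apply: (sup_ubound (vub _ db).2).
  exact: variationsD.
(* The bound is propagated from left to right: [S] collects the points it reaches, the supremum [c]
   belongs to [S] by continuity, and [c < b] would allow a further step. *)
pose S := [set x | a <= x <= b /\ psi x - psi a <= e * (x - a) + V x].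
have Sa : S a by split; rewrite ?lexx ?ab // !subrr mulr0 add0r V0.
have Ssup : has_sup S by split; [exists a|exists b => x [/andP[]]].
pose c := sup S.
have ac : a <= c by apply: (sup_ubound Ssup.2).
have cb : c <= b by apply: ge_sup; [exists a|move=> x [/andP[]]].
have Sc : S c.
  split; first by rewrite ac.
  apply/ler_addgt0Pr => d d0; have [r r0 hr] := pc _ d0.
  have [x Sx xc] := sup_adherent r0 Ssup.
  have xlec : x <= c by apply: (sup_ubound Ssup.2).
  have [/andP[ax xb] hx] := Sx.
  have : `|psi c - psi x| < d by apply: hr => //; rewrite ltrBlDl -ltrBlDr.
  move=> /(le_lt_trans (ler_norm _)) h.
  have := Vmono _ _ xlec cb; have : e * (x - a) <= e * (c - a).
    by rewrite ler_pM2l // lerD2r.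
  by lra.
have Sub x : S x -> x <= c by move=> Sx; apply: (sup_ubound Ssup.2).
case: (ltrgtP c b) cb => // [cb|cb] _; last first.
  have [_ h] := Sc; rewrite cb in h; apply: le_trans h _; rewrite lerD2l.
  apply: ge_sup; first by exists 0.
  by move=> s [n [x [y [[xy tr xyU] ->]]]]; exact: VM.
(* Inside [U] a short step is charged to [V]; outside, the slope hypothesis supplies the step. *)
exfalso; have [Uc|nUc] := pselect (U c).
  have /nbhs_ballP [r /= r0 rU] : nbhs c U by apply: open_nbhs_nbhs.
  pose h := Num.min (r / 2) (b - c).
  have h0 : 0 < h by rewrite lt_min divr_gt0 //= subr_gt0.
  have hb : c + h <= b by rewrite -lerBrDl ge_min lexx orbT.
  have : S (c + h).
    split; first by rewrite hb andbT (le_trans ac) // lerDl ltW.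
    have [_ hc] := Sc.
    have := Vstep c (c + h) ac _ hb; rewrite lerDl (ltW h0) => /(_ isT) H.
    have {}H : V c + `|psi (c + h) - psi c| <= V (c + h).
      apply: H => t /=; rewrite in_itv /= => /andP[ct tch]; apply: rU.
      rewrite /ball /= distrC ger0_norm ?subr_ge0 ?(ltW ct) // ltrBlDl.
      apply: lt_le_trans tch _; rewrite lerD2l ge_min; apply/orP; left.
      by rewrite ler_pdivrMr // ler_pMr // ler1n.
    have := ler_norm (psi (c + h) - psi c).
    have : 0 <= e * h by rewrite mulr_ge0 ?ltW.
    by lra.
  by move=> /Sub; rewrite gerDl leNgt h0.
have [|h h0 [hc hb]] := dini c _ nUc; first by rewrite ac.
have : S (c + h).
  split; first by rewrite hb andbT (le_trans ac) // lerDl ltW.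
  have [_ {}Sc] := Sc; have := Vmono c (c + h).
  rewrite lerDl (ltW h0) hb => /(_ isT isT); lra.
by move=> /Sub; rewrite gerDl leNgt h0.
Qed.

End Creeping.

Lemma sum_disjoint_itv (U : set R) n (x y : 'I_n -> R) (d : R) :
  open U -> (mu U < d%:E)%E -> (forall i, x i <= y i) ->
  trivIset setT (fun i => `]x i, y i[%classic) ->
  (forall i, `]x i, y i[ `<=` U) -> \sum_i (y i - x i) < d.
Proof.
move=> Uo Ud xy tr xyU; rewrite -lte_fin; apply: le_lt_trans Ud.
have -> : (\sum_i (y i - x i))%:E = (\sum_i mu `]x i, y i[%classic)%E.
  rewrite -sumEFin; apply: eq_bigr => i _; rewrite lebesgue_measure_itv /= lte_fin.
  case: ltP => [//|yx]; have -> : y i = x i by apply/eqP; rewrite eq_le yx xy.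
  by rewrite subrr.
rewrite -measure_semi_additive_ord //; last first.
  by apply: bigsetU_measurable => i _; exact: measurable_itv.
apply: le_measure; rewrite ?inE.
- by apply: bigsetU_measurable => i _; exact: measurable_itv.
- exact: open_measurable.
- by rewrite -bigcup_seq => t [i _]; exact: xyU.
Qed.


(** The exceptional null set is covered by an open [U] so small that absolute continuity bounds the
    variation of [psi] inside it by [e / 2]; off [U], [creeping_le] is fed slopes of at most
    [e / 2 / (b - a + 1)]. *)
Lemma dini_le (a b : R) (psi : R -> R) : a <= b ->
  abs_continuous a b (psi : R -> R^o) ->
  {ae mu, forall t, a <= t < b -> forall e, 0 < e ->
    \forall h \near 0^'+, psi (t + h) - psi t <= e * h} ->
  psi b <= psi a.
Proof.
move=> ab ac [N [mN N0 NP]]; apply/ler_addgt0Pr => e e0; rewrite -lerBlDl.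
have e20 : 0 < e / 2 by rewrite divr_gt0.
have [d d0 acd] := ac _ e20.
have muN : (mu N < +oo)%E by rewrite N0.
have [U [Uo NU UNd]] := lebesgue_regularity_outer mN muN d0.
have mU : measurable U by exact: open_measurable.
have Ud : (mu U < d%:E)%E.
  by rewrite -(setDUK NU) setUC measureU0 //; exact: measurableD.
have l0 : 0 < b - a + 1 by rewrite ltr_wpDl // subr_ge0.
have e1 : 0 < e / 2 / (b - a + 1) by rewrite divr_gt0.
have -> : e = e / 2 + e / 2 by rewrite -splitr.
apply: (@le_trans _ _ (e / 2 / (b - a + 1) * (b - a) + e / 2)).
  apply: (creeping_le a b psi U) => //.
  - move=> n x y xy tr xyU; apply/ltW/acd => //.
  by apply: (sum_disjoint_itv U) => // i; have [] := xy i.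
  - exact: abs_continuous_uniform ac.
  - move=> t /andP[at_ tb] nUt.
  have nNt : ~ N t by move=> /NU.
  have Pt : forall e, 0 < e -> \forall h \near 0^'+, psi (t + h) - psi t <= e * h.
    apply: contrapT => nP; apply: nNt; apply: NP => /= h; apply: nP.
    by apply: h; rewrite at_.
  near (0 : R)^'+ => h; exists h; first by near: h; exact: nbhs_right_gt.
  split; first by near: h; exact: Pt.
  by rewrite -lerBrDl; near: h; apply: nbhs_right_ltW; rewrite subr_gt0.
- rewrite lerD2r -mulrA ler_piMr ?(ltW e20) // mulrC ler_pdivrMr // mul1r.
  by rewrite lerDl.
Unshelve. all: by end_near. Qed.

Lemma derivable_near_right {V : normedModType R} (u : R -> V) t :
  derivable u t 1 -> forall e, 0 < e -> \forall h \near 0^'+,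
  `|u (t + h) - u t - h *: derive1 u t| <= e * h.
Proof.
move=> du e e0; have : h^-1 *: (u (h *: 1 + t) - u t) @[h --> 0^'] --> derive1 u t.
  by rewrite derive1E; exact: du.
move=> /cvgrPdist_le /(_ _ e0) ue.
have {}ue : \forall h \near 0^'+,
    `|derive1 u t - h^-1 *: (u (h *: 1 + t) - u t)| <= e.
  by move: ue; rewrite !near_withinE; apply: filterS => h hP h0; apply: hP; rewrite gt_eqF.
near=> h; have h0 : 0 < h by near: h; exact: nbhs_right_gt.
have : `|derive1 u t - h^-1 *: (u (h *: 1 + t) - u t)| <= e by near: h.
rewrite [h *: 1]mulr1 addrC (addrC h) -(@ler_pM2l _ h) // -[X in X * `|_|](gtr0_norm h0).
by rewrite -normrZ scalerDr scalerN scalerA mulfV ?gt_eqF // scale1r mulrC -normrN opprD opprK.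
Unshelve. all: by end_near. Qed.

Section Primitive.
Context (g : R -> R) (g_int : mu.-integrable setT (EFin \o g)).

(** Starting from [-oo] bounds the primitive of a nonnegative integrand by its full integral,
    whatever the initial time. *)
Definition primitive (x : R) : R := \int[mu]_(t in `]-oo, x]) g t.

Lemma primitive_derivable :
  {ae mu, forall x, derivable primitive x 1 /\ derive1 primitive x = g x}.
Proof.
apply: FTC1Ny; first by move=> y; apply: integrableS g_int.
by apply: open_integrable_locally => //; exact: openT.
Qed.

Lemma primitiveB x y : x <= y ->
  primitive y - primitive x = \int[mu]_(t in `]x, y]) g t.
Proof.
move=> xy; apply: Rintegral_itvB; rewrite ?bnd_simp //.
exact: integrableS g_int.
Qed.

Lemma primitive_abs_continuous a b : abs_continuous a b (primitive : R -> R^o).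
Proof.
move=> e e0; have [d [d0 hd]] := integral_normr_continuous g_int e0.
exists d => // n x y xy tr sd.
pose D := \big[setU/set0]_(i < n) `]x i, y i[%classic.
have mD : measurable D by apply: bigsetU_measurable => i _; exact: measurable_itv.
have gi A : measurable A -> mu.-integrable A (EFin \o g).
  by move=> mA; apply: integrableS g_int.
have gni A : measurable A -> mu.-integrable A (fun t => `|g t|%:E).
  move=> mA; have /integrable_abse := gi A mA.
  by apply: eq_integrable => // t _.
have muD : (mu D < d%:E)%E.
  have -> : mu D = (\sum_(i < n) mu `]x i, y i[%classic)%E.
    exact: measure_semi_additive_ord.
  apply: (@le_lt_trans _ _ (\sum_i (y i - x i))%:E); last by rewrite lte_fin.
  rewrite -sumEFin; apply: lee_sum => i _; rewrite lebesgue_measure_itv /= lte_fin.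
  have [_ xyi _] := xy i.
  by case: ltP => // _; rewrite lee_fin subr_ge0.
apply: le_lt_trans (hd D mD muD).
rewrite -lee_fin /Rintegral fineK; last exact: integrable_fin_num (gni D mD).
rewrite /D integral_bigsetU_EFin //.
- rewrite -sumEFin; apply: lee_sum => i _.
  have [_ xyi _] := xy i.
  rewrite primitiveB // -Rintegral_itv_bndo_bndc; last exact: gi.
  rewrite -[leRHS]fineK; last by apply: integrable_fin_num => //; exact: gni.
  by rewrite lee_fin; apply: le_normr_Rintegral => //; exact: gi.
- exact: index_enum_uniq.
- by apply: sub_trivIset tr.
- by apply: measurable_int (gni D mD).
Qed.

(** Almost everywhere [primitive g] has derivative [g], so [dini_le] applies to
    [phi - primitive g]. *)
Lemma dini_le_primitive (a b : R) (phi : R -> R) : a <= b ->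
  abs_continuous a b (phi : R -> R^o) ->
  {ae mu, forall t, a <= t < b -> forall e, 0 < e ->
    \forall h \near 0^'+, phi (t + h) - phi t <= (g t + e) * h} ->
  phi b - phi a <= primitive b - primitive a.
Proof.
move=> ab ac dini.
suff : phi b - primitive b <= phi a - primitive a by lra.
apply: (dini_le a b (fun t => phi t - primitive t)) => //.
  exact: abs_continuousB ac (primitive_abs_continuous a b).
have aeF : Filter (nbhs (almost_everywhere mu)) := ae_filter_ringOfSetsType mu.
apply: filterS2 dini primitive_derivable => t dt [dF F't] /dt{}dt e e0.
have e20 : 0 < e / 2 by rewrite divr_gt0.
have := derivable_near_right _ _ dF _ e20.
apply: filterS2 (dt _ e20) => h; rewrite F't /GRing.scale /= => h1.
rewrite ler_norml; lra.
Qed.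

End Primitive.

End AbsoluteContinuity.

(** * Majorants, half-line integrals and primitives of nonnegative functions *)

Section Majorant.
Context {R : realType}.
Notation mu := (@lebesgue_measure R).

(* The integral of a nonnegative function is a supremum over the simple functions
   below it, whether or not the function is measurable. *)
Lemma ge0_le_integral_nonmeasurable (f1 f2 : R -> \bar R) :
  (forall t, 0 <= f1 t)%E -> (forall t, f1 t <= f2 t)%E ->
  (\int[mu]_t f1 t <= \int[mu]_t f2 t)%E.
Proof.
move=> f10 f12.
have f20 t : (0 <= f2 t)%E by apply: le_trans (f12 t).
rewrite !ge0_integralTE //; apply: le_ereal_sup => _ [h hf <-].
by exists h => // t; apply: le_trans (f12 t).
Qed.

Lemma measurable_norm_simple {V : normedModType R} (s : R -> V) :
  finite_set (range s) -> (forall v, measurable (s @^-1` [set v])) ->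
  measurable_fun setT (fun t => `|s t|).
Proof.
move=> fs ms _ Y mY; rewrite setTI.
have -> : (fun t => `|s t|) @^-1` Y =
    \bigcup_(v in range s `&` [set v | Y `|v|]) (s @^-1` [set v]).
  apply/seteqP; split=> [t Yt|t [v [_ Yv] /= sv]]; last by rewrite -sv in Yv.
  by exists (s t) => //; split=> //; exists t.
by apply: fin_bigcup_measurable => //; exact: finite_setIl.
Qed.

(** Off a null set [N] the simple functions converge to [f] on [D], so the norm of [f] is measurable
    on [D] without [N]; extended by 0 it is the majorant. *)
Lemma bochner_integrable_majorant {V : normedModType R} (D : set R) (f : R -> V) :
  measurable D -> bochner_integrable D f ->
  exists g : R -> R, [/\ mu.-integrable setT (EFin \o g), forall t, 0 <= g t &
    {ae mu, forall t, D t -> `|f t| <= g t}].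
Proof.
move=> mD [[s [sP [N [mN N0 NP]]]] intf].
pose D' := D `\` N.
have mD' : measurable D' by exact: measurableD.
have mf : measurable_fun D' (fun t => `|f t|).
  apply: (@measurable_fun_cvg _ _ _ D' (fun n t => `|s n t|)) => [n|t [Dt Nt]].
    by apply: measurable_funTS; apply: measurable_norm_simple; have [] := sP n.
  apply: cvg_norm; apply: contrapT => nst; apply: Nt; apply: NP => /= h.
  exact: nst (h Dt).
have g0 t : 0 <= ((fun t => `|f t|) \_ D') t by rewrite patchE; case: ifP.
exists ((fun t => `|f t|) \_ D'); split=> //.
- apply/integrableP; split.
    apply/measurable_EFinP; apply/(measurable_restrictT _ _).1 => //.
  apply: le_lt_trans intf; rewrite [leRHS]integral_mkcond.
  (* The norm of [f] may fail to be measurable on [N], so the comparison must not rely on it. *)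
  apply: ge0_le_integral_nonmeasurable => t //=.
  rewrite !patchE; case: ifPn => [/set_mem[Dt _]|_].
    by rewrite mem_set //= normr_id.
  by case: ifP => _; rewrite /= normr0 lee_fin.
- exists N; split=> // t /= h; apply: contrapT => Nt; apply: h => Dt.
  by rewrite patchE mem_set.
Qed.

End Majorant.

Section HalfLine.
Context {R : realType}.
Notation mu := (@lebesgue_measure R).

Lemma continuous_integrable_itv (F : R -> R) a b :
  continuous F -> mu.-integrable `[a, b] (EFin \o F).
Proof.
move=> Fc; apply: continuous_compact_integrable; first exact: segment_compact.
exact: continuous_subspaceT.
Qed.

(** Monotone convergence along the intervals [[t0, t0 + n]]. *)
Lemma ge0_integral_itvcy_lty (F : R -> R) t0 C : continuous F -> (forall t, 0 <= F t) ->
  (forall b, t0 <= b -> \int[mu]_(t in `]t0, b]) F t <= C) ->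
  (\int[mu]_(t in `[t0, +oo[) (F t)%:E < +oo)%E.
Proof.
move=> Fc F0 FC.
have -> : `[t0, +oo[%classic = \bigcup_n `[t0, t0 + n%:R]%classic.
  apply/seteqP; split=> [t|t [n _]] /=; rewrite !in_itv /= ?andbT; last by case/andP.
  move=> t0t; exists (Num.truncn (t - t0)).+1 => //=; rewrite in_itv /= t0t /=.
  by rewrite -lerBlDl ltW // truncnS_gt.
pose I n : set R := `[t0, t0 + n%:R]%classic.
have ndI : nondecreasing_seq I.
  apply/nondecreasing_seqP => n; rewrite subsetEset; apply: subset_itvl.
  by rewrite bnd_simp lerD2l ler_nat.
have mF n : measurable_fun (I n) (EFin \o F).
  apply: measurable_funTS; apply/measurable_EFinP.
  exact: continuous_measurable_fun.
have IF : (\int[mu]_(t in I n) (F t)%:E @[n --> \oo] -->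
    \int[mu]_(t in \bigcup_n I n) (F t)%:E)%E.
  apply: ge0_nondecreasing_set_cvg_integral => //.
    by move=> n; exact: measurable_itv.
  by move=> n t _; rewrite lee_fin.
have <- := cvg_lim _ IF; last exact: ereal_hausdorff.
apply: le_lt_trans (ltry C); apply: lime_le; first by apply/cvg_ex; eexists; exact: IF.
apply: nearW => n; have t0n : t0 <= t0 + n%:R by rewrite lerDl.
have Fi := continuous_integrable_itv F t0 (t0 + n%:R) Fc.
have fin : (\int[mu]_(t in I n) (F t)%:E)%E \is a fin_num.
  by apply: integrable_fin_num => //; exact: measurable_itv.
rewrite -(fineK fin) lee_fin.
apply: le_trans (FC _ t0n); rewrite Rintegral_itv_obnd_cbnd //.
by apply: integrableS Fi => //; exact: subset_itv_oc_cc.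
Qed.

End HalfLine.

Section PrimitiveOrder.
Context {R : realType}.
Notation mu := (@lebesgue_measure R).
Context (g : R -> R) (g_int : mu.-integrable setT (EFin \o g)) (g_ge0 : forall t, 0 <= g t).

Lemma primitive_nondecreasing x y : x <= y -> primitive g x <= primitive g y.
Proof. by move=> xy; rewrite -subr_ge0 primitiveB //; apply: Rintegral_ge0. Qed.

Lemma primitive_le_integral x : primitive g x <= \int[mu]_t g t.
Proof.
have gi A : measurable A -> mu.-integrable A (EFin \o g).
  by move=> mA; apply: integrableS g_int.
rewrite -lee_fin /primitive /Rintegral !fineK; try by apply: integrable_fin_num => //; exact: gi.
apply: ge0_subset_integral => //; first exact: measurable_int (gi setT measurableT).
by move=> t _; rewrite lee_fin.
Qed.

Lemma primitive_ge0 x : 0 <= primitive g x.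
Proof. exact: Rintegral_ge0. Qed.

End PrimitiveOrder.

(** * Asymptotic centres and weak convergence *)

Section AsymptoticCenter.
Context {R : realType} {H : completeNormedModType R} (ip : {dot H for idfun}).
Context (ip_norm : hilbert_norm ip) {I : Type} (u : I -> H) (M : R).

(** Encodes [limsup |u - x|^2 <= c] along [F] as a sublevel set, the form that
    [uniformly_convex_min] takes; the minimizer is the asymptotic centre of [u]. *)
Definition limsup_dist_le (F : set_system I) (c : R) : set H :=
  [set x | forall e, 0 < e -> \forall t \near F, `|u t - x| ^+ 2 <= c + e].

Lemma limsup_dist_leS (F : set_system I) {FF : Filter F} c d :
  c <= d -> limsup_dist_le F c `<=` limsup_dist_le F d.
Proof.
move=> cd x Kx e e0; apply: filterS (Kx e e0) => t; move/le_trans; apply.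
by rewrite lerD2r.
Qed.

(** The parallelogram identity for [u t - x] and [u t - y]. *)
Lemma limsup_dist_le_midpoint (F : set_system I) {FF : Filter F} c x y :
  limsup_dist_le F c x -> limsup_dist_le F c y ->
  limsup_dist_le F (c - 4^-1 * `|x - y| ^+ 2) (2^-1 *: (x + y)).
Proof.
move=> Kx Ky e e0; apply: filterS2 (Kx e e0) (Ky e e0) => t.
have -> : u t - 2^-1 *: (x + y) = 2^-1 *: ((u t - x) + (u t - y)).
  rewrite addrACA -opprD scalerBr (scalerDr _ (u t)) -scalerDl.
  by rewrite (_ : 2^-1 + 2^-1 = 1) ?scale1r //; lra.
have -> : x - y = (u t - y) - (u t - x) by rewrite opprB [RHS]addrC addrA subrK.
rewrite normrZ exprMn (normrD_sqr ip ip_norm (u t - x)) (normrB_sqr ip ip_norm (u t - y)).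
by rewrite (ipC _ (u t - y)) ger0_norm ?invr_ge0 //; lra.
Qed.

Lemma limsup_dist_le_closed (F : set_system I) {FF : Filter F} c :
  (\forall t \near F, `|u t| <= M) -> closed (limsup_dist_le F c).
Proof.
move=> uM x clx e e0.
have N0 : 0 < 2 * (`|M| + `|x| + 1) + 1 by rewrite ltr_wpDl // mulr_ge0 // !addr_ge0.
(* Moving the centre by at most [d] raises [|u t - y|^2] by at most [d * (2 * |u t - y| + d)]; as
   [d <= 1], [|u t - y|] is at most [|M| + |x| + 1]. *)
pose d := Num.min 1 (e / 2 / (2 * (`|M| + `|x| + 1) + 1)).
have d0 : 0 < d by rewrite lt_min ltr01 !divr_gt0.
have [y [Ky]] := clx _ (nbhsx_ballx x d d0).
rewrite -ball_normE /= => xyd.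
have e20 : 0 < e / 2 by rewrite divr_gt0.
apply: filterS2 uM (Ky _ e20) => t utM uty.
have uyM : `|u t - y| <= `|M| + `|x| + 1.
  have -> : u t - y = (u t - x) + (x - y) by rewrite addrA subrK.
  apply: le_trans (ler_normD _ _) (lerD _ _).
    by apply: le_trans (ler_normB _ _) _; rewrite lerD2r (le_trans utM) // ler_norm.
  by apply/ltW/(lt_le_trans xyd); rewrite ge_min lexx.
have -> : u t - x = (u t - y) - (x - y) by rewrite opprB addrA subrK.
have : `|u t - y - (x - y)| <= `|u t - y| + d.
  by apply: le_trans (ler_normB _ _) _; rewrite lerD2l ltW.
rewrite -(@ler_pXn2r _ 2) ?nnegrE ?addr_ge0 ?(ltW d0) // => /le_trans; apply.
have d1 : d <= 1 by rewrite ge_min lexx.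
have : d * (2 * (`|M| + `|x| + 1) + 1) <= e / 2.
  by rewrite -ler_pdivlMr // ge_min lexx orbT.
have : d * (2 * `|u t - y| + d) <= d * (2 * (`|M| + `|x| + 1) + 1).
  by rewrite ler_pM2l // lerD // ler_pM2l.
move: uty; lra.
Qed.

(** Two distinct minimizers would have a midpoint of smaller level. *)
Lemma limsup_dist_le_uniq (F : set_system I) {FF : Filter F} m x y :
  (forall c z, limsup_dist_le F c z -> m <= c) ->
  limsup_dist_le F m x -> limsup_dist_le F m y -> x = y.
Proof.
move=> mP Kx Ky; have := mP _ _ (limsup_dist_le_midpoint _ _ _ _ Kx Ky).
rewrite lerBrDr gerDl pmulr_rle0 ?invr_gt0 // => h.
by apply/eqP; rewrite -subr_eq0 -normr_eq0 -sqrf_eq0 eq_le h exprn_ge0.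
Qed.

Lemma asymptotic_center (F : set_system I) {FF : ProperFilter F} :
  (\forall t \near F, `|u t| <= M) ->
  exists m x, limsup_dist_le F m x /\ forall c y, limsup_dist_le F c y -> m <= c.
Proof.
move=> uM; apply: (@uniformly_convex_min _ _ (limsup_dist_le F) 4^-1 0).
- by rewrite invr_gt0.
- by move=> G GF Gc; exists (lim G); exact: cauchy_cvg.
- by move=> c; exact: limsup_dist_le_closed.
- move=> c x h e e0; have e20 : 0 < e / 2 by rewrite divr_gt0.
  by have := h _ e20 _ e20; rewrite -addrA -splitr.
- by move=> c d; exact: limsup_dist_leS.
- by move=> c x y; exact: limsup_dist_le_midpoint.
- move=> c x Kx; apply/ler_addgt0Pr => e e0.
  have [t] := filter_ex (Kx e e0); apply: le_trans; exact: exprn_ge0.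
- exists (M ^+ 2), 0 => e e0; apply: filterS uM => t utM.
  rewrite subr0 ler_wpDr ?(ltW e0) // ler_pXn2r ?nnegrE //.
  exact: le_trans utM.
Qed.

(** [|u t - T x| <= |u t - x| + |T (u t) - u t|], whose last term tends to 0. With uniqueness, this
    makes every asymptotic centre a fixed point. *)
Lemma limsup_dist_le_nonexpansive (F : set_system I) {FF : Filter F} (T : H -> H) c x :
  (forall x y, `|T x - T y| <= `|x - y|) ->
  (\forall t \near F, `|u t| <= M) ->
  `|T (u t) - u t| @[t --> F] --> (0 : R) ->
  limsup_dist_le F c x -> limsup_dist_le F c (T x).
Proof.
move=> Tne uM r0 Kx e e0.
have N0 : 0 < 2 * (`|M| + `|x|) + 1 by rewrite ltr_wpDl // mulr_ge0 // !addr_ge0.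
pose d := Num.min 1 (e / 2 / (2 * (`|M| + `|x|) + 1)).
have d0 : 0 < d by rewrite lt_min ltr01 !divr_gt0.
have e20 : 0 < e / 2 by rewrite divr_gt0.
move/cvgrPdist_le : r0 => /(_ d d0) r0.
apply: filterS3 uM (Kx _ e20) r0 => t utM utx.
rewrite sub0r normrN normr_id => rd.
have uxM : `|u t - x| <= `|M| + `|x|.
  by apply: le_trans (ler_normB _ _) _; rewrite lerD2r (le_trans utM) // ler_norm.
have : `|u t - T x| <= `|u t - x| + d.
  have -> : u t - T x = (T (u t) - T x) - (T (u t) - u t).
    by rewrite opprB [RHS]addrC addrA subrK.
  by apply: le_trans (ler_normB _ _) (lerD _ _).
rewrite -(@ler_pXn2r _ 2) ?nnegrE ?addr_ge0 ?(ltW d0) // => /le_trans; apply.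
have d1 : d <= 1 by rewrite ge_min lexx.
have : d * (2 * (`|M| + `|x|) + 1) <= e / 2.
  by rewrite -ler_pdivlMr // ge_min lexx orbT.
have : d * (2 * `|u t - x| + d) <= d * (2 * (`|M| + `|x|) + 1).
  by rewrite ler_pM2l // lerD // ler_pM2l.
move: utx; lra.
Qed.

Lemma limsup_dist_le_cvg (F : set_system I) {FF : Filter F} x l :
  `|u t - x| ^+ 2 @[t --> F] --> l -> limsup_dist_le F l x.
Proof.
move=> /cvgrPdist_le ul e e0; apply: filterS (ul e e0) => t.
by rewrite ler_norml; lra.
Qed.

Lemma limsup_dist_ge_cvg (F : set_system I) {FF : ProperFilter F} x l c :
  `|u t - x| ^+ 2 @[t --> F] --> l -> limsup_dist_le F c x -> l <= c.
Proof.
move=> /cvgrPdist_le ul Kx; apply/ler_addgt0Pr => e e0.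
have e20 : 0 < e / 2 by rewrite divr_gt0.
have [t []] := filter_ex (filterI (ul _ e20) (Kx _ e20)).
by rewrite ler_norml; lra.
Qed.

End AsymptoticCenter.

Section Opial.
Context {R : realType} {H : completeNormedModType R} (ip : {dot H for idfun}).
Context (ip_norm : hilbert_norm ip) (u : R -> H) (M : R) (T : H -> H).

Lemma opial_nonexpansive :
  (forall x y, `|T x - T y| <= `|x - y|) ->
  (\forall t \near +oo, `|u t| <= M) ->
  `|T (u t) - u t| @[t --> +oo] --> (0 : R) ->
  (forall p, Fix T p -> exists l : R, `|u t - p| ^+ 2 @[t --> +oo] --> l) ->
  exists2 p, Fix T p & weak_cvg ip u p.
Proof.
move=> Tne uM r0 lims.
have center_Fix (F : set_system R) (FF : ProperFilter F) m x : F --> +oo ->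
    limsup_dist_le u F m x -> (forall c y, limsup_dist_le u F c y -> m <= c) -> Fix T x.
  move=> Foo Kx mP; apply/esym.
  apply: (limsup_dist_le_uniq ip ip_norm u F m _ _ mP Kx).
  apply: (limsup_dist_le_nonexpansive u M) => //; first exact: Foo.
  exact: cvg_trans (cvg_app _ Foo) r0.
have [m [x [Kx mP]]] := asymptotic_center ip ip_norm u M +oo uM.
have Tx : Fix T x by apply: (center_Fix _ _ _ _ cvg_id Kx mP).
exists x; first exact: Tx.
suff key v e : 0 < e -> \forall t \near +oo, ip (u t - x) v <= e.
  move=> v; apply/cvgrPdist_le => e e0.
  apply: filterS2 (key v e e0) (key (- v) e e0) => t.
  by rewrite !ipE ler_norml; lra.
(* Otherwise [u] has an asymptotic centre along [S], which must again be [x], yet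
   moving [x] in the direction [v] brings it closer to [u] on [S]. *)
move=> e0; apply: contrapT => nle.
pose S := [set t | e < ip (u t - x) v].
pose F : set_system R := within S +oo.
have FF : ProperFilter F.
  apply: Build_ProperFilter_ex.
  move=> P /= FP; apply: contrapT => nP; apply: nle.
  apply: (@filterS _ (+oo : set_system R) _ _ _ _ FP) => t Pt.
  by rewrite leNgt; apply/negP => et; apply: nP; exists t; apply: Pt.
have Foo : F --> +oo by apply: cvg_within.
have [m' [x' [Kx' mP']]] := asymptotic_center ip ip_norm u M F (Foo _ uM).
have Tx' : Fix T x' by apply: (center_Fix _ _ _ _ Foo Kx' mP').
have [l ul] := lims _ Tx; have [l' ul'] := lims _ Tx'.
have ulF : `|u t - x| ^+ 2 @[t --> F] --> l by exact: cvg_trans (cvg_app _ Foo) ul.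
have ulF' : `|u t - x'| ^+ 2 @[t --> F] --> l' by exact: cvg_trans (cvg_app _ Foo) ul'.
(* [l <= m <= l' <= m'], and the limits [l] and [l'] persist along the finer filter [F]; so [x]
   attains the minimum [m'] along [F] too. *)
have lm' : l <= m'.
  apply: le_trans (limsup_dist_ge_cvg _ _ _ _ _ ulF' Kx').
  apply: le_trans (limsup_dist_ge_cvg _ _ _ _ _ ul Kx) _.
  exact: mP (limsup_dist_le_cvg _ _ _ _ ul').
have {}Kx : limsup_dist_le u F m' x.
  exact: limsup_dist_leS lm' _ (limsup_dist_le_cvg _ _ _ _ ulF).
(* This [s] gives [s * |v|^2 < e], so the move lowers the level below the minimum [m']. *)
pose s := e / (`|v| ^+ 2 + 1).
have v0 : 0 < `|v| ^+ 2 + 1 by rewrite ltr_wpDl // exprn_ge0.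
have s0 : 0 < s by rewrite divr_gt0.
have /mP' : limsup_dist_le u F (m' - 2 * s * e + s ^+ 2 * `|v| ^+ 2) (x + s *: v).
  move=> d d0; have SF : \forall t \near F, S t by apply: withinT.
  apply: filterS2 SF (Kx d d0) => t; rewrite /S /= => et utx.
  have -> : u t - (x + s *: v) = (u t - x) - s *: v by rewrite opprD addrA.
  rewrite (normrB_sqr ip ip_norm) normrZ exprMn (gtr0_norm s0) ipZr.
  have : s * e <= s * ip (u t - x) v by rewrite ler_pM2l // ltW.
  lra.
have : s * (`|v| ^+ 2 + 1) = e by rewrite mulfVK // gt_eqF.
have := exprn_ge0 2 (normr_ge0 v); nra.
Qed.

End Opial.

(** * The perturbed flow of a nonexpansive operator *)

Section Flow.
Context {R : realType} {H : completeNormedModType R} (ip : {dot H for idfun}).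
Context (ip_norm : hilbert_norm ip).
Notation mu := (@lebesgue_measure R).
Context (t0 theta0 : R) (theta g : R -> R) (f u : R -> H) (T : H -> H).
Context (theta0_gt0 : 0 < theta0) (theta_ge : forall t, t0 <= t -> theta0 <= theta t).
Context (g_int : mu.-integrable setT (EFin \o g)) (g_ge0 : forall t, 0 <= g t).
Context (f_le_g : {ae mu, forall t, t0 <= t -> `|f t| <= g t}).
Context (u_ac : forall b, t0 < b -> abs_continuous t0 b u).
Context (u_ode : {ae mu, forall t, t0 <= t ->
  derivable u t 1 /\ derive1 u t + theta t *: (u t - T (u t)) = f t}).
Context (T_coco : forall x y, `|(x - T x) - (y - T y)| ^+ 2 / 2 <=
  ip (x - y) ((x - T x) - (y - T y))).
Context (T_ne : forall x y, `|T x - T y| <= `|x - y|).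

(** An explicit Euler step of the unperturbed equation, a convex combination of [u t] and [T (u t)]
    when [0 <= h * theta t <= 1]. *)
Let euler h t := u t - (h * theta t) *: (u t - T (u t)).

(** Substituting the equation for the derivative leaves the differentiation error plus
    [h *: f t]. *)
Lemma flow_euler_step : {ae mu, forall t, t0 <= t -> forall e, 0 < e ->
  \forall h \near 0^'+, [/\ 0 < h, h * theta t <= 1 &
    `|u (t + h) - euler h t| <= (g t + e) * h]}.
Proof.
have aeF : Filter (nbhs (almost_everywhere mu)) := ae_filter_ringOfSetsType mu.
apply: filterS2 u_ode f_le_g => t ode fg t0t e e0.
have [du uE] := ode t0t; have {}fg := fg t0t.
have th0 : 0 < theta t by apply: lt_le_trans (theta_ge _ t0t).
near=> h.
have h0 : 0 < h by near: h; exact: nbhs_right_gt.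
have hu : `|u (t + h) - u t - h *: derive1 u t| <= e * h.
  by near: h; exact: derivable_near_right.
split=> //.
  by rewrite -ler_pdivlMr // mul1r; near: h; apply: nbhs_right_le; rewrite invr_gt0.
have -> : u (t + h) - euler h t = (u (t + h) - u t - h *: derive1 u t) + h *: f t.
  rewrite -uE scalerDr addrA subrK scalerA.
  by rewrite /euler opprD opprK addrA.
apply: le_trans (ler_normD _ _) _; rewrite mulrDl [leLHS]addrC lerD //.
by rewrite normrZ gtr0_norm // mulrC ler_pM2r.
Unshelve. all: by end_near. Qed.

Let flow_abs_continuous (V : normedModType R) a b c (v : R -> V) : t0 <= a ->
  (forall x y, a <= x <= b -> a <= y <= b -> `|v y - v x| <= c * `|u y - u x|) ->
  abs_continuous a b v.
Proof.
move=> t0a vu; apply: (abs_continuous_comp a b c u) vu _ => e e0.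
have t0b : t0 < Num.max b t0 + 1 by rewrite ltr_pwDr // le_max lexx orbT.
have [d d0 hd] := u_ac _ t0b _ e0; exists d => // n x y xy; apply: hd => i.
have [ax xyi yb] := xy i; split=> //; first exact: le_trans ax.
by rewrite ler_wpDr // le_max yb.
Qed.

Context (p : H) (Tp : Fix T p).

(** The dissipation: the unperturbed flow decreases [|u - p|^2] at the rate
    [2 * theta t * energy t]. *)
Let energy t := ip (u t - p) (u t - T (u t)).

Let residual_le t : `|u t - T (u t)| ^+ 2 / 2 <= energy t.
Proof. by have := T_coco (u t) p; rewrite (Tp : T p = p) subrr subr0. Qed.

Let energy_ge0 t : 0 <= energy t.
Proof. by apply: le_trans (residual_le t); rewrite divr_ge0 // exprn_ge0. Qed.

(** The Euler step does not increase the distance to [p], so only its error, of rate [g],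
    contributes. *)
Lemma flow_fejer a b : t0 <= a -> a <= b ->
  `|u b - p| - `|u a - p| <= primitive g b - primitive g a.
Proof.
move=> t0a ab; apply: (dini_le_primitive g g_int a b (fun t => `|u t - p|)) => //.
  apply: (flow_abs_continuous _ _ _ 1) => // x y _ _; rewrite mul1r.
  rewrite (le_trans (ler_dist_dist _ _)) // opprB addrA subrK //.
have aeF : Filter (nbhs (almost_everywhere mu)) := ae_filter_ringOfSetsType mu.
apply: filterS flow_euler_step => t step /andP[at_ tb] e e0.
have t0t := le_trans t0a at_; have th0 := lt_le_trans theta0_gt0 (theta_ge _ t0t).
apply: filterS (step t0t e e0) => h [h0 hth uh].
rewrite lerBlDl; apply: le_trans (lerD (lexx _) uh).
have -> : u (t + h) - p = (euler h t - p) + (u (t + h) - euler h t).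
  by rewrite [RHS]addrC addrA subrK.
apply: le_trans (ler_normD _ _) _; rewrite lerD2r /euler.
have s0 : 0 <= h * theta t by rewrite mulr_ge0 // ltW.
move: (h * theta t) hth s0 => s hth s0.
have -> : u t - s *: (u t - T (u t)) - p = (1 - s) *: (u t - p) + s *: (T (u t) - T p).
  rewrite (Tp : T p = p) scalerBl scale1r addrAC -[RHS]addrA; congr (_ + _).
  rewrite [RHS]addrC -scalerBr -scalerN; congr (_ *: _).
  by rewrite !opprB addrA subrK.
apply: le_trans (ler_normD _ _) _; rewrite !normrZ (ger0_norm s0) ger0_norm ?subr_ge0 //.
have := ler_wpM2l s0 (T_ne (u t) p); lra.
Qed.

(** The Euler step does not increase the residual [|y - T y|]; since [I - T] is 2-Lipschitz, the
    error of the step counts twice. *)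
Lemma flow_residual a b : t0 <= a -> a <= b ->
  `|u b - T (u b)| - `|u a - T (u a)| <= 2 * (primitive g b - primitive g a).
Proof.
move=> t0a ab; rewrite mulrC -ler_pdivrMr // mulrBl.
apply: (dini_le_primitive g g_int a b (fun t => `|u t - T (u t)| / 2)) => //.
  apply: (flow_abs_continuous _ _ _ 1) => // x y _ _.
  rewrite -mulrBl normrM (@ger0_norm _ 2^-1) // ler_pdivrMr // mul1r mulrC mulr2n mulrDl mul1r.
  apply: le_trans (ler_dist_dist _ _) _.
  have -> : u y - T (u y) - (u x - T (u x)) = (u y - u x) - (T (u y) - T (u x)).
    by rewrite !opprD addrACA.
  by rewrite (le_trans (ler_normB _ _)) // lerD2l.
have aeF : Filter (nbhs (almost_everywhere mu)) := ae_filter_ringOfSetsType mu.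
apply: filterS flow_euler_step => t step /andP[at_ tb] e e0.
have t0t := le_trans t0a at_; have th0 := lt_le_trans theta0_gt0 (theta_ge _ t0t).
apply: filterS (step t0t e e0) => h [h0 hth uh].
rewrite -mulrBl ler_pdivrMr // lerBlDl.
suff ne : `|euler h t - T (euler h t)| <= `|u t - T (u t)|.
  have -> : u (t + h) - T (u (t + h)) = (euler h t - T (euler h t))
    + ((u (t + h) - euler h t) - (T (u (t + h)) - T (euler h t))).
    by rewrite addrACA -opprD !subrKC.
  have ne' := T_ne (u (t + h)) (euler h t).
  have nb := ler_normB (u (t + h) - euler h t) (T (u (t + h)) - T (euler h t)).
  apply: le_trans (ler_normD _ _) _; lra.
have s0 : 0 <= h * theta t by rewrite mulr_ge0 // ltW.
rewrite /euler; move: (h * theta t) hth s0 => s hth s0.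
set y := u t - _.
have -> : y - T y = (1 - s) *: (u t - T (u t)) + (T (u t) - T y).
  by rewrite scalerBl scale1r addrA [X in _ = X - _]addrAC subrK.
have uy : `|T (u t) - T y| <= s * `|u t - T (u t)|.
  apply: le_trans (T_ne _ _) _.
  by rewrite /y opprB addrCA subrr addr0 normrZ ger0_norm.
apply: le_trans (ler_normD _ _) _.
rewrite normrZ ger0_norm ?subr_ge0 //; lra.
Qed.

Let M := `|u t0 - p| + \int[mu]_t g t.

Let M_ge0 : 0 <= M.
Proof. by rewrite addr_ge0 //; apply: Rintegral_ge0. Qed.

Lemma flow_bounded t : t0 <= t -> `|u t - p| <= M.
Proof.
move=> t0t; rewrite -lerBlDl; apply: le_trans (flow_fejer _ _ (lexx _) t0t) _.
have := primitive_le_integral g g_int g_ge0 t.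
by have := primitive_ge0 g g_ge0 t0; lra.
Qed.

(** Nothing constrains [u] before [t0]; freezing it there gives a function continuous on the whole
    line. *)
Let v t := u (Num.max t0 t).

Let v_continuous : continuous v.
Proof.
move=> t; apply/cvgrPdist_lt => e e0.
have t0b : t0 < Num.max t0 t + 1 by rewrite ltr_pwDr // le_max lexx.
have [d d0 hd] := abs_continuous_uniform _ _ _ (u_ac _ t0b) _ e0.
have d'0 : 0 < Num.min d 1 by rewrite lt_min d0 /=.
near=> s.
have st : `|t - s| < Num.min d 1.
  by near: s; apply: (@cvgr_dist_lt _ _ _ _ _ id t).
have [std st1] : `|t - s| < d /\ `|t - s| < 1 by apply/andP; rewrite -lt_min.
have mst : `|Num.max t0 t - Num.max t0 s| <= `|t - s|.
  have := ler_norm (t - s); have := ler_norm (s - t); rewrite (distrC s) => h1 h2.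
  by rewrite ler_norml; case: (leP t0 t) => ?; case: (leP t0 s) => ?; lra.
have sb : Num.max t0 s <= Num.max t0 t + 1.
  by move: mst st1; rewrite ler_norml; lra.
rewrite /v; case: (leP (Num.max t0 s) (Num.max t0 t)) => [|/ltW] h.
  apply: hd => //; rewrite ?le_max ?lexx // ?lerDl //.
  by apply: le_lt_trans (le_lt_trans mst std); exact: ler_norm.
rewrite distrC; apply: hd => //; rewrite ?le_max ?lexx //.
by apply: le_lt_trans (le_lt_trans mst std); rewrite distrC; exact: ler_norm.
Unshelve. all: by end_near. Qed.

Let T_continuous : continuous T.
Proof.
move=> x; apply/cvgrPdist_lt => e e0; near=> y.
by apply: le_lt_trans (T_ne x y) _; near: y; apply: (@cvgr_dist_lt _ _ _ _ _ id x).
Unshelve. all: by end_near. Qed.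

Let E t := ip (v t - p) (v t - T (v t)).

Let E_continuous : continuous E.
Proof.
move=> t; apply: (ip_cvg2 ip ip_norm); apply: cvgB; try exact: v_continuous.
  exact: cvg_cst.
by apply: (cvg_comp _ _ (v_continuous t)); exact: T_continuous.
Qed.

Let E_energy t : t0 <= t -> E t = energy t.
Proof. by move=> t0t; rewrite /E /v max_r. Qed.

Lemma flow_energy_dini t : t0 <= t ->
  (forall e, 0 < e -> \forall h \near 0^'+, [/\ 0 < h, h * theta t <= 1 &
    `|u (t + h) - euler h t| <= (g t + e) * h]) ->
  forall e, 0 < e -> \forall h \near 0^'+,
    `|u (t + h) - p| ^+ 2 - `|u t - p| ^+ 2 <=
    (2 * M * g t - 2 * theta0 * energy t + e) * h.
Proof.
move=> t0t step e e0; have th0 := lt_le_trans theta0_gt0 (theta_ge _ t0t).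
pose e1 := e / (4 * M + 4).
have M4 : 0 < 4 * M + 4 by move: M_ge0; lra.
have e10 : 0 < e1 by rewrite divr_gt0.
have Me1 : 2 * M * e1 <= e / 2.
  have : e1 * (4 * M + 4) = e by rewrite divfK // gt_eqF.
  by lra.
(* [c] collects the coefficients of [h ^+ 2], from the squared Euler increment and the squared
   error; a small [h] absorbs them into [e / 2]. *)
pose c := 2 * theta t ^+ 2 * energy t + (g t + e1) ^+ 2.
have c0 : 0 <= c.
  apply: addr_ge0; last exact: sqr_ge0.
  by apply: mulr_ge0; first by apply: mulr_ge0 => //; exact: sqr_ge0.
have c1 : 0 < c + 1 by rewrite ltr_wpDl.
near=> h.
have [h0 hth uh] : [/\ 0 < h, h * theta t <= 1 & `|u (t + h) - euler h t| <= (g t + e1) * h].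
  by near: h; exact: step.
have hc : h * (c + 1) <= e / 2.
  by rewrite -ler_pdivlMr //; near: h; apply: nbhs_right_le; rewrite !divr_gt0.
have s0 : 0 <= h * theta t by rewrite mulr_ge0 // ltW.
have xE : `|euler h t - p| ^+ 2 <= `|u t - p| ^+ 2 - 2 * (h * theta t) * energy t
    + 2 * (h * theta t) ^+ 2 * energy t.
  have -> : euler h t - p = (u t - p) - (h * theta t) *: (u t - T (u t)).
    by rewrite /euler addrAC.
  rewrite (normrB_sqr ip ip_norm) normrZ exprMn (ger0_norm s0) ipZr -/(energy t).
  have := ler_wpM2l (exprn_ge0 2 s0) (residual_le t).
  lra.
have xM : `|euler h t - p| <= M.
  apply: le_trans (flow_bounded _ t0t).
  rewrite -(@ler_pXn2r _ 2) ?nnegrE //; apply: le_trans xE _.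
  have := mulr_ge0 (mulr_ge0 s0 (energy_ge0 t)) (_ : 0 <= 1 - h * theta t).
  rewrite subr_ge0 => /(_ hth); lra.
set w := (g t + e1) * h in uh.
have w0 : 0 <= w by rewrite mulr_ge0 ?addr_ge0 // ltW.
have : `|u (t + h) - p| ^+ 2 <= (`|euler h t - p| + w) ^+ 2.
  rewrite ler_pXn2r ?nnegrE ?addr_ge0 //.
  have -> : u (t + h) - p = (euler h t - p) + (u (t + h) - euler h t).
    by rewrite [RHS]addrC addrA subrK.
  by apply: le_trans (ler_normD _ _) _; rewrite lerD2l.
have : `|euler h t - p| * w <= M * w by rewrite ler_wpM2r.
have : theta0 * (h * energy t) <= theta t * (h * energy t).
  by rewrite ler_wpM2r ?theta_ge // mulr_ge0 // ltW.
have : h * (h * (c + 1)) <= h * (e / 2) by rewrite ler_pM2l.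
have : h * (2 * M * e1) <= h * (e / 2) by rewrite ler_pM2l.
have := sqr_ge0 h.
move: xE; rewrite /c /w; lra.
Unshelve. all: by end_near. Qed.

Lemma flow_lyapunov b : t0 <= b ->
  2 * theta0 * (\int[mu]_(t in `]t0, b]) E t) <= M ^+ 2 + 2 * M * (\int[mu]_t g t).
Proof.
move=> t0b.
(* Restricting [E] to [[t0, b]] makes the rate integrable on the whole line. *)
pose k t := 2 * M * g t - 2 * theta0 * (E \_ `[t0, b]) t.
have Ei : mu.-integrable setT (EFin \o (E \_ `[t0, b])).
  rewrite -restrict_EFin; apply/integrable_restrict => //.
  by rewrite setTI; exact: continuous_integrable_itv.
have gMi : mu.-integrable setT (EFin \o (fun t => 2 * M * g t)).
  have := integrableZl measurableT (2 * M) g_int.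
  by apply: eq_integrable => // t _; rewrite /= EFinM.
have Eti : mu.-integrable setT (EFin \o (fun t => 2 * theta0 * (E \_ `[t0, b]) t)).
  have := integrableZl measurableT (2 * theta0) Ei.
  by apply: eq_integrable => // t _; rewrite /= EFinM.
have ki : mu.-integrable setT (EFin \o k).
  have := integrableB measurableT gMi Eti.
  by apply: eq_integrable => // t _; rewrite /= EFinB.
have := dini_le_primitive k ki t0 b (fun t => `|u t - p| ^+ 2) t0b.
rewrite (primitiveB _ ki _ _ t0b).
have -> : \int[mu]_(t in `]t0, b]) k t =
    2 * M * (\int[mu]_(t in `]t0, b]) g t) - 2 * theta0 * (\int[mu]_(t in `]t0, b]) E t).
  have sub A (h : R -> R) : measurable A -> mu.-integrable setT (EFin \o h) ->
    mu.-integrable A (EFin \o h) by move=> mA; exact: integrableS.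
  rewrite /k RintegralB //; try exact: sub.
  rewrite !RintegralZl //; try exact: sub.
  congr (_ - _ * _); apply: eq_Rintegral => t; rewrite inE /= in_itv /= => /andP[t0t tb].
  by rewrite patchE mem_set //= in_itv /= (ltW t0t).
move=> H1.
have {}H1 : `|u b - p| ^+ 2 - `|u t0 - p| ^+ 2 <=
  2 * M * (\int[mu]_(t in `]t0, b]) g t) - 2 * theta0 * (\int[mu]_(t in `]t0, b]) E t).
  apply: H1.
    apply: (flow_abs_continuous _ _ _ (2 * M)) => // x y /andP[t0x _] /andP[t0y _].
    rewrite subr_sqr normrM mulrC.
    apply: ler_pM => //.
      rewrite (le_trans (ler_normD _ _)) // !normr_id mulrC mulr_natr mulr2n.
      by rewrite lerD //; exact: flow_bounded.
    by rewrite (le_trans (ler_dist_dist _ _)) // opprB addrA subrK.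
  have aeF : Filter (nbhs (almost_everywhere mu)) := ae_filter_ringOfSetsType mu.
  apply: filterS flow_euler_step => t step /andP[t0t tb] e e0.
  rewrite /k patchE mem_set /= ?in_itv /= ?t0t ?(ltW tb) // E_energy //.
  exact: flow_energy_dini (step t0t) _ e0.
have gb : \int[mu]_(t in `]t0, b]) g t <= \int[mu]_t g t.
  rewrite -(primitiveB _ g_int _ _ t0b).
  by have := primitive_le_integral g g_int g_ge0 b; have := primitive_ge0 g g_ge0 t0; lra.
have := ler_wpM2l (mulr_ge0 (ler0n R 2) M_ge0) gb.
have : `|u t0 - p| ^+ 2 <= M ^+ 2 by rewrite ler_pXn2r ?nnegrE // flow_bounded.
have := exprn_ge0 2 (normr_ge0 (u b - p)).
lra.
Qed.

Lemma flow_integral_lty (G : R -> R) c : 0 <= c ->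
  (forall t, t0 <= t -> 0 <= G t <= c * energy t) ->
  (\int[mu]_(t in `[t0, +oo[) (G t)%:E < +oo)%E.
Proof.
move=> c0 Gc.
have E0 t : 0 <= E t by rewrite /E /v; exact: energy_ge0.
have cEc : continuous (fun t => c * E t).
  by move=> t; apply: cvgMr; exact: E_continuous.
have cE : (\int[mu]_(t in `[t0, +oo[) (c * E t)%:E < +oo)%E.
  apply: (ge0_integral_itvcy_lty (fun t => c * E t) t0
    (c * ((M ^+ 2 + 2 * M * (\int[mu]_t g t)) / (2 * theta0))) cEc).
    by move=> t; rewrite mulr_ge0.
  move=> b t0b; rewrite RintegralZl //; last first.
    apply: integrableS (continuous_integrable_itv E t0 b E_continuous) => //.
    exact: subset_itv_oc_cc.
  by rewrite ler_wpM2l // ler_pdivlMr ?mulr_gt0 // mulrC flow_lyapunov.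
apply: le_lt_trans cE.
rewrite [leLHS]integral_mkcond [leRHS]integral_mkcond.
apply: ge0_le_integral_nonmeasurable => t; rewrite !patchE; case: ifPn => //.
  by rewrite inE /= in_itv /= andbT => /Gc/andP[G0 _]; rewrite lee_fin.
rewrite inE /= in_itv /= andbT => t0t; rewrite lee_fin E_energy //.
by case/andP: (Gc _ t0t).
Qed.

(** A residual that stayed above [e / 2] would keep [energy] above [e ^+ 2 / 8] on a half-line,
    against its integrability. Once the residual is below [e / 2], it grows by at most twice a tail
    of [g], that is by [e / 2]. *)
Lemma flow_residual_cvg : `|T (u t) - u t| @[t --> +oo] --> (0 : R).
Proof.
apply/cvgrPdist_le => e e0.
have e4 : 0 < e / 4 by rewrite divr_gt0.
pose S := range (primitive g).
have Ssup : has_sup S.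
  split; first by exists (primitive g 0), 0.
  by exists (\int[mu]_t g t) => _ [t _ <-]; exact: primitive_le_integral.
have [_ [t1 _ <-] t1S] := sup_adherent e4 Ssup.
have tail a b : t1 <= a -> a <= b -> primitive g b - primitive g a <= e / 4.
  move=> t1a ab; have := primitive_nondecreasing g g_int g_ge0 _ _ t1a.
  have : primitive g b <= sup S by apply: (sup_ubound Ssup.2); exists b.
  by lra.
pose t2 := Num.max t0 t1.
have [s t2s rs] : exists2 s, t2 <= s & `|u s - T (u s)| < e / 2.
  apply: contrapT => nex.
  have big s : t2 <= s -> e ^+ 2 / 8 <= energy s.
    move=> t2s; apply: le_trans (residual_le s).
    have : e / 2 <= `|u s - T (u s)|.
      by rewrite leNgt; apply/negP => ?; apply: nex; exists s.
    rewrite -(@ler_pXn2r _ 2) ?nnegrE ?divr_ge0 ?(ltW e0) //; lra.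
  pose G := cst (e ^+ 2 / 8) \_ `[t2, +oo[.
  have : (\int[mu]_(t in `[t0, +oo[) (G t)%:E < +oo)%E.
    apply: (flow_integral_lty G 1) => // t t0t; rewrite mul1r /G patchE.
    case: ifPn => [|_]; last by rewrite lexx energy_ge0.
    rewrite inE /= in_itv /= andbT => /big ->; rewrite andbT.
    by rewrite divr_ge0 // exprn_ge0 // ltW.
  have sub : (`[t2, +oo[%classic : set R) `<=` `[t0, +oo[%classic.
    by move=> t /=; rewrite !in_itv /= !andbT; apply: le_trans; rewrite le_max lexx.
  have -> : (\int[mu]_(t in `[t0, +oo[) (G t)%:E =
      \int[mu]_(t in `[t2, +oo[) (e ^+ 2 / 8)%:E)%E.
    rewrite [LHS]integral_mkcond [RHS]integral_mkcond; apply: eq_integral => t _.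
    rewrite /G !patchE; case: (boolP (t \in `[t2, +oo[%classic)) => [|_].
      by rewrite inE => /sub t0t; rewrite mem_set.
    by case: ifP.
  have -> : (\int[mu]_(t in `[t2, +oo[) (e ^+ 2 / 8)%:E =
      (e ^+ 2 / 8)%:E * mu `[t2, +oo[%classic)%E by exact: integral_cst.
  rewrite lebesgue_measure_itv /= ltry.
  by rewrite addye // mulry gtr0_sg ?divr_gt0 ?exprn_gt0 // mul1e ltxx.
exists s; split; first exact: num_real.
move=> t /ltW st /=; rewrite sub0r normrN normr_id distrC.
have [t0s t1s] : t0 <= s /\ t1 <= s by apply/andP; rewrite -ge_max.
have := flow_residual _ _ t0s st; have := tail _ _ t1s st; lra.
Qed.

(** By [flow_fejer], [primitive g - |u - p|] is nondecreasing after [t0]; it and [primitive g] are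
    bounded above, so their difference converges. *)
Lemma flow_dist_cvg : exists l : R, `|u t - p| ^+ 2 @[t --> +oo] --> l.
Proof.
pose P t := primitive g (Num.max t0 t).
have maxS x y : x <= y -> Num.max t0 x <= Num.max t0 y.
  by move=> xy; rewrite ge_max !le_max lexx xy orbT.
have Pub t : P t <= \int[mu]_t g t by exact: primitive_le_integral.
have Pcvg : P t @[t --> +oo] --> sup (range P).
  apply: nondecreasing_cvgr; last by exists (\int[mu]_t g t) => _ [t _ <-].
  by move=> x y xy; apply: primitive_nondecreasing => //; exact: maxS.
pose Q t := P t - `|v t - p|.
have Qcvg : Q t @[t --> +oo] --> sup (range Q).
  apply: nondecreasing_cvgr.
    move=> x y xy; rewrite /Q /P /v.
    have := flow_fejer (Num.max t0 x) (Num.max t0 y).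
    by rewrite le_max lexx => /(_ isT (maxS _ _ xy)); lra.
  exists (\int[mu]_t g t) => _ [t _ <-]; apply: le_trans (Pub t).
  by rewrite gerBl.
have vcvg : `|v t - p| @[t --> +oo] --> sup (range P) - sup (range Q).
  by apply: cvg_trans (cvgB Pcvg Qcvg); apply: near_eq_cvg; apply: nearW => t;
    rewrite /Q /= opprB addrC subrK.
exists ((sup (range P) - sup (range Q)) * (sup (range P) - sup (range Q))).
apply: cvg_trans (cvgM vcvg vcvg); apply: near_eq_cvg.
exists t0; split; first exact: num_real.
by move=> t /ltW t0t; rewrite /v /= max_r.
Qed.

End Flow.

(** * Convergence of the adaptive Douglas-Rachford trajectory *)

Theorem theorem4p3 (R : realType) (H : completeNormedModType R)
    (ip : {dot H for idfun}) (ip_norm : hilbert_norm ip)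
    (t0 : R) (t0_gt0 : 0 < t0)
    (theta : R -> R) (theta_ge0 : forall t, t0 <= t -> 0 <= theta t)
    (theta_int : locally_integrable_from t0 theta)
    (f : R -> H) (f_int : bochner_integrable `[t0, +oo[ f)
    (A B : H -> set H) (alpha beta : R)
    (A_max : maximally_monotone_op ip alpha A)
    (B_max : maximally_monotone_op ip beta B)
    (alpha_beta : 0 <= alpha + beta)
    (gamma delta lambda mu : R)
    (gamma_gt0 : 0 < gamma) (delta_gt0 : 0 < delta)
    (lambda_ge1 : 1 <= lambda) (mu_ge1 : 1 <= mu)
    (gamma_alpha : 0 < 1 + 2 * gamma * alpha)
    (mu_itv : 2 - 2 * gamma * beta <= mu <= 2 + 2 * gamma * alpha)
    (lambda_mu : (lambda - 1) * (mu - 1) = 1)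
    (delta_def : delta = (lambda - 1) * gamma)
    (zer_neq0 : zer_sum A B !=set0)
    (theta_inf : 0 < inf [set theta t | t in `[t0, +oo[]) :
  let JA := resolvent gamma A in
  let RA := relaxed_resolvent gamma lambda A in
  let JB := resolvent delta B in
  let RB := relaxed_resolvent delta mu B in
  let T := RB \o RA in
  forall (u0 : H) (u : R -> H),
  strong_global_solution t0 theta T f u0 u ->
  forall eps : R, 0 < eps < 1 ->
  let w1 := eps * mu * (2 + 2 * gamma * alpha - mu) in
  let w2 := eps * mu * (mu - (2 - 2 * gamma * beta)) in
  forall ustar : H, Fix T ustar ->
  let W t := w1 *: (JA (u t) - JA ustar) +
             w2 *: (JB (RA (u t)) - JB (RA ustar)) in
  [/\ (\int[@lebesgue_measure R]_(s in `[t0, +oo[)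
         (`|T (u s) - u s| ^+ 2)%:E < +oo)%E,
      `|T (u t) - u t| @[t --> +oo] --> (0 : R),
      exists2 uhat : H, Fix T uhat & weak_cvg ip u uhat
    & 0 < alpha + beta ->
      (\int[@lebesgue_measure R]_(s in `[t0, +oo[)
         (`|W s| ^+ 2)%:E < +oo)%E /\
      `|W t| @[t --> +oo] --> (0 : R) /\
      JA (u t) @[t --> +oo] --> JA ustar /\
      JB (RA (u t)) @[t --> +oo] --> JB (RA ustar) /\
      JA ustar = JB (RA ustar) /\
      zer_sum A B = [set JA ustar]].
Proof.
move=> JA RA JB RB T u0 u [u_ac u_ode u_t0] eps /andP[eps0 eps1] w1 w2 ustar Tustar W.
pose theta0 := inf [set theta t | t in `[t0, +oo[].
have theta_ge t : t0 <= t -> theta0 <= theta t.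
  move=> t0t; apply: ge_inf; last by exists t => //=; rewrite in_itv /= t0t.
  by exists 0 => _ [s /= + <-]; rewrite in_itv /= andbT; exact: theta_ge0.
have [g [g_int g_ge0 f_le_g']] := bochner_integrable_majorant _ _ (measurable_itv _) f_int.
have {}f_le_g : {ae (@lebesgue_measure R), forall t, t0 <= t -> `|f t| <= g t}.
  have aeF : Filter (nbhs (almost_everywhere (@lebesgue_measure R))) :=
    ae_filter_ringOfSetsType _.
  by apply: filterS f_le_g' => t + t0t; apply; rewrite /= in_itv /= t0t.
have T_ne x y : `|T x - T y| <= `|x - y|.
  exact: (DouglasRachford_nonexpansive ip ip_norm A B alpha beta).
have T_coco x y : `|(x - T x) - (y - T y)| ^+ 2 / 2 <= ip (x - y) ((x - T x) - (y - T y)).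
  exact: (DouglasRachford_cocoercive ip ip_norm A B alpha beta).
have subT x : x - T x = mu *: (JA x - JB (RA x)).
  exact: sub_DouglasRachford.
have mu0 : 0 < mu by apply: lt_le_trans mu_ge1.
pose k1 := 2 + 2 * gamma * alpha - mu; pose k2 := mu - (2 - 2 * gamma * beta).
have [k1_ge0 k2_ge0] : 0 <= k1 /\ 0 <= k2.
  by case/andP: mu_itv => ? ?; rewrite /k1 /k2; lra.
pose r t := u t - T (u t).
pose En t := ip (u t - ustar) (r t).
pose a t := JA (u t) - JA ustar; pose b t := JB (RA (u t)) - JB (RA ustar).
have EnP t : `|r t| ^+ 2 / 2 + mu / 2 * (k1 * `|a t| ^+ 2 + k2 * `|b t| ^+ 2) <= En t.
  have := DouglasRachford_monotone ip ip_norm A B alpha beta gamma delta lambda mu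
    A_max B_max gamma_gt0 delta_gt0 mu_ge1 gamma_alpha mu_itv lambda_mu delta_def
    (u t) ustar.
  by rewrite -/RA -/RB -/JA -/JB -/T (Tustar : T ustar = ustar) subrr subr0.
have k_ge0 t : 0 <= mu / 2 * (k1 * `|a t| ^+ 2 + k2 * `|b t| ^+ 2).
  by rewrite mulr_ge0 ?divr_ge0 ?(ltW mu0) // addr_ge0 // mulr_ge0 // exprn_ge0.
have integral_lty := flow_integral_lty ip ip_norm t0 theta0 theta g f u T theta_inf
  theta_ge g_int g_ge0 f_le_g u_ac u_ode T_coco T_ne ustar Tustar.
have residual_cvg : `|T (u t) - u t| @[t --> +oo] --> (0 : R).
  exact: (flow_residual_cvg ip ip_norm t0 theta0 theta g f u T theta_inf
    theta_ge g_int g_ge0 f_le_g u_ac u_ode T_coco T_ne ustar Tustar).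
have u_bounded := flow_bounded t0 theta0 theta g f u T theta_inf
  theta_ge g_int g_ge0 f_le_g u_ac u_ode T_ne ustar Tustar.
set M := _ + _ in u_bounded.
have near_ge (P : set R) : (forall t, t0 <= t -> P t) -> \forall t \near +oo, P t.
  by move=> Pt; exists t0; split; [exact: num_real|move=> t /ltW /Pt].
split=> //.
- apply: (integral_lty _ 2) => // t t0t; rewrite exprn_ge0 //= distrC -/(r t) -/(En t).
  by have := EnP t; have := k_ge0 t; lra.
- apply: (opial_nonexpansive ip ip_norm u (M + `|ustar|)) => //.
    apply: near_ge => t /u_bounded uM; rewrite -[u t](subrK ustar).
    by apply: le_trans (ler_normD _ _) _; rewrite lerD2r.
  move=> p Tp; exact: (flow_dist_cvg t0 theta0 theta g f u T theta_inf
    theta_ge g_int g_ge0 f_le_g u_ac u_ode T_ne p Tp).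
move=> ab0.
(* At least one weight is positive, but the other may vanish, so [a] and [b] have to be controlled
   jointly. *)
have k0 : 0 < k1 + k2.
  have -> : k1 + k2 = 2 * (gamma * (alpha + beta)) by rewrite /k1 /k2; ring.
  by rewrite !mulr_gt0.
have WE t : W t = (eps * mu) *: (k1 *: a t + k2 *: b t).
  by rewrite scalerDr !scalerA.
(* Convexity of the squared norm: the gap is [(eps * mu) ^+ 2 * k1 * k2 * |a t - b t|^2]. *)
have W_le t : `|W t| ^+ 2 <= (eps * mu) ^+ 2 * (k1 + k2) * (k1 * `|a t| ^+ 2 + k2 * `|b t| ^+ 2).
  rewrite WE normrZ exprMn (ger0_norm (ltW (mulr_gt0 eps0 mu0))) -mulrA.
  rewrite ler_wpM2l ?sqr_ge0 //.
  have := mulr_ge0 (mulr_ge0 k1_ge0 k2_ge0) (exprn_ge0 2 (normr_ge0 (a t - b t))).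
  rewrite (normrD_sqr ip ip_norm (k1 *: a t)) (normrB_sqr ip ip_norm (a t)).
  rewrite !normrZ !exprMn (ger0_norm k1_ge0) (ger0_norm k2_ge0) ipZl ipZr.
  by lra.
have En_cvg e : 0 < e -> \forall t \near +oo, `|r t| ^+ 2 <= e /\ En t <= e.
  move=> e0.
  have M1 : 0 < M + 1.
    by rewrite ltr_wpDl //; apply: le_trans (u_bounded _ (lexx t0)).
  (* The bounds 1 and [e] make [|r t|^2] at most [e]; the bound [e / (M + 1)] serves the
     Cauchy-Schwarz estimate [En t <= M * |r t|]. *)
  have d0 : 0 < Num.min (Num.min 1 e) (e / (M + 1)) by rewrite !lt_min ltr01 e0 divr_gt0.
  move/cvgrPdist_le : residual_cvg => /(_ _ d0) rd.
  apply: filterS2 rd (near_ge _ u_bounded) => t.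
  rewrite sub0r normrN normr_id distrC -/(r t) !le_min => /andP[/andP[r1 re] rM] uM.
  split; first by rewrite expr2 (le_trans _ re) // ler_piMl.
  apply: le_trans (ler_norm _) _; apply: le_trans (CauchySchwarz_ip ip ip_norm _ _) _.
  move: rM; rewrite ler_pdivlMr // mulrC; apply: le_trans.
  by rewrite ler_wpM2r // (le_trans uM) // lerDl.
have fixE : JA ustar = JB (RA ustar).
  exact: (Fix_DouglasRachford A B gamma delta lambda mu).
have ab_r t : r t = mu *: (a t - b t).
  rewrite /r subT /a /b -fixE.
  by congr (_ *: _); rewrite opprB addrA subrK.
have ab_cvg e : 0 < e -> \forall t \near +oo, `|a t| <= e /\ `|b t| <= e.
  move=> e0.
  (* Both the weighted sum of squares and [|a t - b t| = |r t| / mu] are small. Trading squares by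
     [|b|^2 <= 2 |a|^2 + 2 |a - b|^2], and symmetrically, bounds [k1 + k2] times either square by
     [4 / mu * d + 2 * (k1 + k2) / mu ^+ 2 * d]; [d] makes this [(k1 + k2) * e ^+ 2]. *)
  pose d := (k1 + k2) * e ^+ 2 / (4 / mu + 2 * (k1 + k2) / mu ^+ 2).
  have c0 : 0 < 4 / mu + 2 * (k1 + k2) / mu ^+ 2.
    by rewrite addr_gt0 ?divr_gt0 ?mulr_gt0 ?exprn_gt0.
  have d0 : 0 < d by rewrite divr_gt0 // mulr_gt0 // exprn_gt0.
  have dE : 4 / mu * d + 2 * (k1 + k2) / mu ^+ 2 * d = (k1 + k2) * e ^+ 2.
    by rewrite -mulrDl mulrC divfK // gt_eqF.
  apply: filterS (En_cvg d d0) => t [rd Ed].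
  have rE : `|a t - b t| ^+ 2 <= d / mu ^+ 2.
    rewrite ler_pdivlMr ?exprn_gt0 // mulrC; apply: le_trans rd.
    by rewrite ab_r normrZ exprMn gtr0_norm.
  have kE : k1 * `|a t| ^+ 2 + k2 * `|b t| ^+ 2 <= 2 / mu * d.
    have := EnP t; have := exprn_ge0 2 (normr_ge0 (r t)).
    have -> : 2 / mu * d = d / (mu / 2) by field; rewrite gt_eqF.
    by rewrite ler_pdivlMr ?divr_gt0 // mulrC; lra.
  have ba2 : `|b t| ^+ 2 <= 2 * `|a t| ^+ 2 + 2 * `|a t - b t| ^+ 2.
    have := exprn_ge0 2 (normr_ge0 (2 *: a t - b t)).
    rewrite (normrB_sqr ip ip_norm (a t)) (normrB_sqr ip ip_norm (2 *: a t)).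
    by rewrite normrZ exprMn ger0_norm // ipZl; lra.
  have ab2 : `|a t| ^+ 2 <= 2 * `|b t| ^+ 2 + 2 * `|a t - b t| ^+ 2.
    have := exprn_ge0 2 (normr_ge0 (2 *: b t - a t)).
    rewrite (normrB_sqr ip ip_norm (a t)) (normrB_sqr ip ip_norm (2 *: b t)).
    by rewrite normrZ exprMn ger0_norm // ipZl (ipC _ (b t)); lra.
  have {}rE : (k1 + k2) * `|a t - b t| ^+ 2 <= (k1 + k2) * (d / mu ^+ 2).
    by rewrite ler_pM2l.
  have k1ab := ler_wpM2l k1_ge0 ba2; have k2ab := ler_wpM2l k2_ge0 ab2.
  have e1 := mulr_ge0 k1_ge0 (exprn_ge0 2 (normr_ge0 (a t - b t))).
  have e2 := mulr_ge0 k2_ge0 (exprn_ge0 2 (normr_ge0 (a t - b t))).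
  have e3 := mulr_ge0 k1_ge0 (exprn_ge0 2 (normr_ge0 (a t))).
  have e4 := mulr_ge0 k2_ge0 (exprn_ge0 2 (normr_ge0 (b t))).
  have sq (x : R) : 0 <= x -> (k1 + k2) * x ^+ 2 <= (k1 + k2) * e ^+ 2 -> x <= e.
    by move=> x0; rewrite ler_pM2l // ler_pXn2r ?nnegrE // ltW.
  by split; apply: sq => //; rewrite -dE; lra.
have cvg_of (V : normedModType R) (v : R -> V) (l : V) :
    (forall e, 0 < e -> \forall t \near +oo, `|v t - l| <= e) -> v t @[t --> +oo] --> l.
  by move=> vl; apply/cvgrPdist_le => e /vl; apply: filterS => t; rewrite distrC.
split.
  have c0 : 0 <= (eps * mu) ^+ 2 * (k1 + k2).
    by apply: mulr_ge0; [exact: sqr_ge0|exact: ltW].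
  apply: (integral_lty _ ((eps * mu) ^+ 2 * (k1 + k2) * (2 / mu))).
    by rewrite mulr_ge0 // divr_ge0 // ltW.
  move=> t t0t; rewrite exprn_ge0 //=; apply: le_trans (W_le t) _.
  rewrite -[leRHS]mulrA ler_wpM2l // -/(r t) -/(En t).
  have := EnP t; have := exprn_ge0 2 (normr_ge0 (r t)).
  have -> : 2 / mu * En t = En t / (mu / 2) by field; rewrite gt_eqF.
  by rewrite ler_pdivlMr ?divr_gt0 // mulrC; lra.
split.
  apply: cvg_of => e e0.
  have c0 : 0 < `|w1| + `|w2| + 1 by rewrite ltr_wpDl // addr_ge0.
  have [d d0 dE] : exists2 d, 0 < d & (`|w1| + `|w2| + 1) * d = e.
    by exists (e / (`|w1| + `|w2| + 1)); rewrite ?divr_gt0 // mulrC divfK // gt_eqF.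
  apply: filterS (ab_cvg _ d0) => t [ad bd]; rewrite subr0 normr_id.
  rewrite /W; apply: le_trans (ler_normD _ _) _; rewrite (normrZ w1) (normrZ w2).
  have := ler_wpM2l (normr_ge0 w1) ad; have := ler_wpM2l (normr_ge0 w2) bd.
  move: dE.
  by rewrite /a /b; lra.
split; first by apply: cvg_of => e /ab_cvg; apply: filterS => t [].
split; first by apply: cvg_of => e /ab_cvg; apply: filterS => t [].
split; first exact: fixE.
exact: (zer_sum_DouglasRachford ip ip_norm A B alpha beta gamma delta lambda mu).
Qed.
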